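(* Let $n\ge1$, let $\mathcal{X}\subseteq\mathbb{R}^{n}$ be a finite set with $|\mathcal{X}|\ge2$, and let $c(x,y)=\Vert x-y\Vert_{p}^{q}$, where $p\in[1,\infty)\cup\{\infty\}$ and $q\ge1$. Then \[ r_{c}^{*}(\mathcal{P}(\mathcal{X}))<28.66\,n^{\max\{1/p,\,1-1/p\}}\,\gamma^{q-1}\log\left(\frac{\gamma}{n^{\max\{1/p,\,1-1/p\}}}+1\right), \] where \[ \gamma:=\frac{\max\{\Vert x-y\Vert_{p}:\,x,y\in\mathcal{X}\}}{\min\{\Vert x-y\Vert_{p}:\,x,y\in\mathcal{X},\,x\neq y\}}. \]
   Context: Logarithms are natural; $1/p=0$ if $p=\infty$. Polish spaces carry their Borel $\sigma$-algebras. A symmetric cost function over a Polish space $\mathcal{X}$ is a function $c:\mathcal{X}^2\to[0,\infty)$ that is measurable with respect to the product $\sigma$-algebra, symmetric, not identically zero, and satisfies $c(x,x)=0$ for all $x$. $\mathcal{P}(\mathcal{X})$ is the set of all probability distributions over $\mathcal{X}$. A coupling of a collection $\{P_\alpha\}_{\alpha\in\mathcal{A}}$ of probability distributions over $\mathcal{X}$ ($\mathcal{A}$ an arbitrary index set) is a family of random variables $X_\alpha:[0,1]\to\mathcal{X}$, all defined on the standard probability space ($[0,1]$, Lebesgue measurable sets, Lebesgue measure), with $X_\alpha\sim P_\alpha$ for every $\alpha$. For $P,Q\in\mathcal{P}(\mathcal{X})$, $C_c^*(P,Q):=\inf\mathbf{E}[c(X,Y)]$ over couplings $(X,Y)$ of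 $(P,Q)$. The pairwise coupling ratio of a coupling is $r_c(\{X_\alpha\}_{\alpha}):=\inf\{r\ge1:\mathbf{E}[c(X_\alpha,X_\beta)]\le r\,C_c^*(P_\alpha,P_\beta)\ \forall\alpha,\beta\in\mathcal{A}\}$ ($\infty$ if no such $r$ exists), and $r_c^*(\{P_\alpha\}_{\alpha}):=\inf r_c(\{X_\alpha\}_\alpha)$ over all couplings of $\{P_\alpha\}_\alpha$. A set of probability distributions, such as $\mathcal{P}(\mathcal{X})$, is regarded as a collection indexed by itself. *)

(* Defs.v *)
From HB Require Import structures.
From mathcomp Require Import all_boot all_order all_algebra finmap.
From mathcomp Require Import all_classical all_reals all_analysis.

Set Implicit Arguments.
Unset Strict Implicit.
Unset Printing Implicit Defensive.
Import Order.TTheory GRing.Theory Num.Theory.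
Import numFieldNormedType.Exports.

Local Open Scope classical_set_scope.
Local Open Scope ring_scope.

Section standard_probability_space.
Context {R : realType}.

Lemma lebesgue_measurable_unit :
  (wlength (idfun : R -> R))^*%mu.-cara.-measurable `[0 : R, 1]%classic.
Proof. by apply: sub_caratheodory; exact: measurable_itv. Qed.

(* [0, 1] with its Lebesgue measurable (not merely Borel) sets, as a measure on
   the whole line that ignores the complement of [0, 1]: a random variable on
   it is a Lebesgue measurable function on R, whose values outside [0, 1] are
   irrelevant. *)
Definition unit_lebesgue :=
  mrestr (@completed_lebesgue_measure R) lebesgue_measurable_unit.

HB.instance Definition _ := Measure.on unit_lebesgue.

Let unit_lebesgueT : unit_lebesgue setT = 1%E.
Proof.
rewrite /unit_lebesgue /mrestr setTI.
have -> : completed_lebesgue_measure `[0 : R, 1]%classic =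
         lebesgue_measure `[0 : R, 1]%classic.
  by [].
by rewrite lebesgue_measure_itv/= lte_fin ltr01 oppr0 adde0.
Qed.

HB.instance Definition _ :=
  Measure_isProbability.Build _ _ _ unit_lebesgue unit_lebesgueT.

End standard_probability_space.

Notation unit_RV R T := {RV (@unit_lebesgue R : probability _ R) >-> T}.

Section couplings.
Context {R : realType} {d : measure_display} {T : measurableType d}.
Local Open Scope ereal_scope.

Definition has_law (X : unit_RV R T) (P : probability T R) :=
  forall B, measurable B -> distribution unit_lebesgue X B = P B.

Definition mean_cost (c : T -> T -> R) (X Y : unit_RV R T) : \bar R :=
  'E_(unit_lebesgue)[fun t => c (X t) (Y t)].

Definition optimal_cost (c : T -> T -> R) (P Q : probability T R) : \bar R :=
  ereal_inf [set e | exists X Y : unit_RV R T,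
    [/\ has_law X P, has_law Y Q & e = mean_cost c X Y]].

Context {I : Type}.
Implicit Types (P : I -> probability T R) (X : I -> unit_RV R T).

Definition is_coupling P X := forall i, has_law (X i) (P i).

Definition coupling_ratio (c : T -> T -> R) P X : \bar R :=
  ereal_inf [set r%:E | r in [set r : R | (1 <= r)%R /\
    forall i j, mean_cost c (X i) (X j) <= r%:E * optimal_cost c (P i) (P j)]].

Definition optimal_coupling_ratio (c : T -> T -> R) P : \bar R :=
  ereal_inf [set coupling_ratio c P X | X in is_coupling P].

End couplings.

(* Measurable types are pointed, hence the nonemptiness argument; the topology
   is the subspace topology that set_type inherits from E. *)
Definition subset_space (E : topologicalType) (A : set E) (A0 : A !=set0) :
  Type := set_type A.

Section subset_space.
Context (E : topologicalType) (A : set E) (A0 : A !=set0).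

HB.instance Definition _ := Topological.on (subset_space A0).

Definition subset_space_point : subset_space A0 :=
  let: exist x Ax := cid A0 in exist _ x (mem_set Ax).

HB.instance Definition _ := isPointed.Build (subset_space A0) subset_space_point.

End subset_space.

Notation borel T := (g_sigma_algebraType (@open T)).

Section lp.
Context {R : realType} {n : nat}.
Implicit Types (p : \bar R) (X : {fset 'rV[R]_n}).

(* Only used for 1 <= p. *)
Definition lp_norm p (x : 'rV[R]_n) : R :=
  if p is r%:E then (\sum_(i < n) `|x 0 i| `^ r) `^ r^-1
  else \big[Num.max/0]_(i < n) `|x 0 i|.

(* The supremum and the infimum are a maximum and a minimum because X is
   finite (with at least two points, for the infimum). *)
Definition lp_aspect_ratio p X : R :=
  sup [set lp_norm p (x - y) | x in [set` X] & y in [set` X]] /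
  inf [set r | exists x y,
         [/\ x \in X, y \in X, x != y & r = lp_norm p (x - y)]].

Definition lp_cost p (q : R) (A : set 'rV[R]_n) (A0 : A !=set0)
    (x y : borel (subset_space A0)) : R :=
  lp_norm p (set_val x - set_val y) `^ q.

End lp.

Definition einvr {R : realType} (p : \bar R) : R :=
  if p is r%:E then r^-1 else 0.

Lemma fset_gt1_nonempty {K : choiceType} (X : {fset K}) :
  (1 < #|` X|)%N -> [set` X] !=set0.
Proof. by move/ltnW; rewrite cardfs_gt0 => /fset0Pn. Qed.

(* Main.v *)
Require Import Defs.
From HB Require Import structures.
From mathcomp Require Import all_boot all_order all_algebra finmap.
From mathcomp Require Import all_classical all_reals all_analysis.
From mathcomp Require Import measurable_realfun ring lra.

(** Since [X] is finite, all laws on it have to be coupled on one copy of [0, 1].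
    Correlated sampling (rejection sampling with shared proposals) draws, from common
    randomness, a point of law [mu] for every [mu], in such a way that the draws for [mu]
    and [nu] differ with probability at most [(1 + eps) * |mu - nu|_1].  It is applied
    hierarchically.  At the scale [D = diam / 4 ^ k], a point [x] is sent to a random
    grid vertex [z] with weight [\prod_i cos ((pi / 2) * (x_i / w - z_i)) ^ 2], where
    [w = D / (2 * n ^ (1 / p))]; one samples the vertex seen by [P] and goes on with the
    posterior law of [x].  Points that see the same vertex are at distance at most [D], so
    separating [P] from [Q] at the next scale costs [D] times the total variation distance
    of the next vertices.  By Cauchy-Schwarz this distance is controlled by the Hellinger
    affinity of the weights, which is [1 - O ((|x - y|_2 / w) ^ 2)] and multiplicative along
    the scales, so the contributions of the coarser scales form a geometric series.  The
    Euclidean norm enters only through [n ^ (1 / p) * |h|_2 <= m * |h|_p], with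
    [m = n ^ max (1 / p) (1 - 1 / p)].  Every scale costs at most [36.15 * m] times
    the optimal cost, and [log_4 (gamma / (16 * m))] scales suffice (none if
    [gamma <= 16 * m]).  The exponent [q] only contributes [gamma ^ (q - 1)], because
    [gap ^ (q - 1) * d <= d ^ q <= diam ^ (q - 1) * d]. *)

Set Implicit Arguments.
Unset Strict Implicit.
Unset Printing Implicit Defensive.
Import Order.TTheory GRing.Theory Num.Theory.
Import numFieldNormedType.Exports.

Local Open Scope classical_set_scope.
Local Open Scope ring_scope.

(** * Splitting a uniform variable into two independent ones *)

Section unit_probability.
Context {R : realType}.
Notation TR := (measurableTypeR R).
Notation lam := (@lebesgue_measure R).
Implicit Types A B : set TR.

Definition unit_itv : set TR := `[0, 1[%classic.

Lemma measurable_unit_itv : measurable unit_itv.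
Proof. exact: measurable_itv. Qed.

Definition pr A : R := fine (lam (A `&` unit_itv)).

Lemma lam_unit_itv : lam unit_itv = 1%E.
Proof. by rewrite /unit_itv lebesgue_measure_itv/= lte_fin ltr01 oppr0 adde0. Qed.

Lemma pr_fin A : measurable A -> lam (A `&` unit_itv) = (pr A)%:E.
Proof.
move=> mA; rewrite fineK// ge0_fin_numE//.
apply: (@le_lt_trans _ _ (lam unit_itv)); last by rewrite lam_unit_itv ltry.
apply: le_measure; rewrite ?inE//; last exact: measurable_unit_itv.
by apply: measurableI => //; exact: measurable_unit_itv.
Qed.

Lemma pr_ge0 A : 0 <= pr A. Proof. by rewrite fine_ge0. Qed.

Lemma pr_setT : pr setT = 1.
Proof. by rewrite /pr setTI lam_unit_itv. Qed.

Lemma pr_set0 : pr set0 = 0.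
Proof. by rewrite /pr set0I measure0. Qed.

Lemma prU A B : measurable A -> measurable B -> A `&` B = set0 ->
  pr (A `|` B) = pr A + pr B.
Proof.
move=> mA mB AB; apply: EFin_inj; rewrite EFinD -!pr_fin//; last exact: measurableU.
rewrite setIUl measureU//; try by apply: measurableI => //; exact: measurable_unit_itv.
by rewrite setIACA AB set0I.
Qed.

Lemma le_pr A B : measurable A -> measurable B -> A `<=` B -> pr A <= pr B.
Proof.
move=> mA mB AB; rewrite -lee_fin -!pr_fin//.
apply: le_measure; rewrite ?inE; try by apply: measurableI => //; exact: measurable_unit_itv.
exact: setSI.
Qed.

Lemma pr_le1 A : measurable A -> pr A <= 1.
Proof. by move=> mA; rewrite -pr_setT le_pr. Qed.

(** For [c = 0] and [c = 1], the two inverse branches of the doubling map of [[0, 1)]: the binary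
    digit [c] is put in front of those of [t]. *)
Definition half_branch (c t : R) : R := (c + t) / 2.

Lemma measurable_half_branch c : measurable_fun [set: TR] (half_branch c : TR -> TR).
Proof. by apply: measurable_funM => //; exact: measurable_funD. Qed.

(** Uniqueness of Lebesgue measure: half of its image under a map of slope [1 / 2] gives every []a,
    b]] its length. *)
Lemma lam_half_branch c A : measurable A ->
  lam A = (2^-1%:E * lam (half_branch c @^-1` A))%E.
Proof.
move=> mA.
have mh := measurable_half_branch c.
have h0 : (0 <= 2^-1 :> R) by rewrite invr_ge0.
rewrite (@lebesgue_measure_unique R (mscale (NngNum h0) (pushforward lam (half_branch c : TR -> TR)))) //.
move=> _ [[a b] _ <-] /=.
rewrite /mscale/= /pushforward.
have -> : half_branch c @^-1` `]a, b]%classic = `](2 * a - c), (2 * b - c)]%classic.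
  apply/seteqP; split => t /=; rewrite !in_itv/= /half_branch => /andP[? ?];
  by apply/andP; split; lra.
rewrite !lebesgue_measure_itv/= !lte_fin.
have -> : (2 * a - c < 2 * b - c) = (a < b) by apply/idP/idP; lra.
case: ifP => // _; last by rewrite mule0.
by rewrite -!EFinD -EFinM; congr (_%:E); lra.
Qed.

(** Conditioning on the first binary digit: each half of [[0, 1)] is the image of [[0, 1)] under one
    branch. *)
Lemma pr_split A : measurable A ->
  pr A = 2^-1 * pr (half_branch 0 @^-1` A) + 2^-1 * pr (half_branch 1 @^-1` A).
Proof.
move=> mA.
have mpre c : measurable (half_branch c @^-1` A : set TR).
  by rewrite -[X in measurable X]setTI; exact: measurable_half_branch.
have mI (a b : R) : measurable (A `&` `[a, b[%classic : set TR).
  by apply: measurableI => //; exact: measurable_itv.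
have mU : measurable (A `&` unit_itv) by exact: mI.
have -> : pr A = fine (lam (A `&` `[0, 2^-1[%classic)) +
                 fine (lam (A `&` `[2^-1, 1[%classic)).
  apply: EFin_inj; rewrite -pr_fin// EFinD !fineK; last 2 first.
  - rewrite ge0_fin_numE//; apply: (@le_lt_trans _ _ (lam (A `&` unit_itv))).
      apply: le_measure; rewrite ?inE//.
move=> t [At /=]; rewrite in_itv/= => ?; split => //; rewrite /unit_itv /= in_itv/=; lra.
    by rewrite pr_fin// ltry.
  - rewrite ge0_fin_numE//; apply: (@le_lt_trans _ _ (lam (A `&` unit_itv))).
      apply: le_measure; rewrite ?inE//.
      move=> t [At /=]; rewrite in_itv/= => ?; split => //; rewrite /unit_itv /= in_itv/=; lra.
    by rewrite pr_fin// ltry.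
  rewrite -measureU//.
    congr lam; rewrite -setIUr; congr (_ `&` _); apply/seteqP; split => t;
    rewrite /unit_itv /= !in_itv/=.
      by move=> /andP[? ?]; have [?|?] := ltP t 2^-1; [left|right]; lra.
    by case; lra.
  apply/seteqP; split => t //= [[_ +] [_]]; rewrite !in_itv/=; lra.
rewrite (lam_half_branch 0)// (lam_half_branch 1 (A := A `&` `[2^-1, 1[%classic))//.
have e0 : half_branch 0 @^-1` (A `&` `[0, 2^-1[%classic) =
    half_branch 0 @^-1` A `&` unit_itv.
  apply/seteqP; split => t /= [At]; rewrite /unit_itv/half_branch/= !in_itv/= => ?;
  by split => //; rewrite ?in_itv/=; lra.
have e1 : half_branch 1 @^-1` (A `&` `[2^-1, 1[%classic) =
    half_branch 1 @^-1` A `&` unit_itv.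
  apply/seteqP; split => t /= [At]; rewrite /unit_itv/half_branch/= !in_itv/= => ?;
  by split => //; rewrite ?in_itv/=; lra.
by rewrite e0 e1 !pr_fin//= .
Qed.

End unit_probability.

(** * Independence of the even and the odd binary digits *)

Section pairing.
Context {R : realType}.
Notation TR := (measurableTypeR R).
Notation lam := (@lebesgue_measure R).
Implicit Types A B : set TR.

Lemma eq_pr A B : (forall t, 0 <= t < 1 -> A t <-> B t) -> pr A = pr B.
Proof.
move=> AB; rewrite /pr; congr (fine (lam _)); apply/seteqP.
by split => t [? U]; split => //; apply/AB => //; move: U; rewrite /unit_itv/= in_itv.
Qed.

Lemma finite_measure_eq (m1 m2 : {measure set TR -> \bar R}) :
  (m1 setT < +oo)%E -> (forall a b, m1 `]a, b]%classic = m2 `]a, b]%classic) ->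
  forall A, measurable A -> m1 A = m2 A.
Proof.
move=> m1oo m12 A mA.
apply: (@measure_unique _ R TR (@ocitv R) (fun k => `](- k%:R), k%:R]%classic) _ _ _ _ m1 m2 _ _ A mA) => //.
- exact: ocitvI.
- by move=> k; exact: is_ocitv.
- apply/seteqP; split => // t _.
  exists (Num.truncn `|t|).+1 => //=; rewrite in_itv/=.
  have tn : `|t| < (Num.truncn `|t|).+1%:R by exact: truncnS_gt.
  have := ler_norm t; have := ler_norm (- t); rewrite normrN => ? ?.
  by apply/andP; split; lra.
- by move=> _ [[a b] _ <-].
- move=> k; apply: le_lt_trans m1oo; apply: le_measure; rewrite ?inE//.
Qed.

(** Extends a product formula from rays to Borel sets, one factor at a time: [f] extracts one half
    of the digits, [E] is an event about the other half and [c] is its probability. Both sides are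
    finite measures in [A], determined by their values on half-open intervals. *)
Lemma pr_pushforward_unique (f : TR -> TR) (E : set TR) (c : R) :
  measurable_fun setT f -> measurable E -> 0 <= c ->
  (forall x, pr (E `&` f @^-1` `]-oo, x]%classic) = c * pr `]-oo, x]%classic) ->
  forall A, measurable A -> pr (E `&` f @^-1` A) = c * pr A.
Proof.
move=> mf mE c0 Ef A mA.
have mEU : measurable (E `&` unit_itv : set TR).
  by apply: measurableI => //; exact: measurable_unit_itv.
have mpre B : measurable B -> measurable (E `&` f @^-1` B).
  by move=> mB; apply: measurableI => //; rewrite -[X in measurable X]setTI; exact: mf.
pose m0 : {measure set TR -> \bar R} := pushforward (mrestr lam mEU) f.
pose m1 := m0 mf.
pose m2 : {measure set TR -> \bar R} := mscale (NngNum c0) (mrestr lam (@measurable_unit_itv R)).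
have m1E B : measurable B -> m1 B = (pr (E `&` f @^-1` B))%:E.
  move=> mB; rewrite /m1/m0/= /pushforward /mrestr -pr_fin; last exact: mpre.
  by rewrite setIA [in f @^-1` _ `&` _]setIC.
have m2E B : measurable B -> m2 B = (c * pr B)%:E.
  by move=> mB; rewrite /m2/= /mscale/= /mrestr pr_fin// EFinM.
apply: EFin_inj; rewrite -m1E// -m2E//.
apply: (@finite_measure_eq m1 m2) => //.
  by rewrite m1E ?ltry.
move=> a b.
have [ba|ab] := leP b a; first by rewrite set_itv_ge ?bnd_simp -?leNgt// !measure0.
rewrite m1E// m2E//; congr (_%:E).
have U : `]-oo, b]%classic = `]-oo, a]%classic `|` `]a, b]%classic :> set R.
  by apply/seteqP; split => t /=; rewrite !in_itv/=; [case: (leP t a); lra | lra].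
have I : `]-oo, a]%classic `&` `]a, b]%classic = set0 :> set R.
  by apply/seteqP; split => t //= []; rewrite !in_itv/=; lra.
have := Ef b; have := Ef a; rewrite U preimage_setU setIUr !prU//; try exact: mpre.
  by rewrite mulrDr => -> /addrI.
by rewrite setIACA setIid -preimage_setI I preimage_set0 setI0.
Qed.

(* [even_part] and [odd_part] gather every other binary digit of [t]. *)
Definition bit (t : R) : R := if t < 2^-1 then 0 else 1.
Definition bit_shift (t : R) : R := 2 * t - bit t.

Fixpoint even_bits k (t : R) : R :=
  if k is k'.+1 then bit t / 2 + even_bits k' (bit_shift (bit_shift t)) / 2 else 0.

Definition even_part (t : R) : R := limn (even_bits ^~ t).

Lemma bit_bound t : 0 <= bit t <= 1.
Proof. by rewrite /bit; case: ifP; lra. Qed.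

Lemma even_bits_bound k t : 0 <= even_bits k t <= 1.
Proof.
elim: k t => [|k IH] t /=; first by lra.
by have := bit_bound t; have := IH (bit_shift (bit_shift t)); lra.
Qed.

Lemma even_bits_nd t : nondecreasing_seq (even_bits ^~ t).
Proof.
apply/nondecreasing_seqP => k; elim: k t => [|k IH] t.
  by have /andP[] := even_bits_bound 1 t.
by have := IH (bit_shift (bit_shift t)); rewrite /=; lra.
Qed.

Lemma even_bits_cvg t : even_bits ^~ t @ \oo --> even_part t.
Proof.
apply: nondecreasing_is_cvgn; first exact: even_bits_nd.
by exists 1 => _ [k _ <-]; have /andP[] := even_bits_bound k t.
Qed.

Lemma even_part_rec t :
  even_part t = bit t / 2 + even_part (bit_shift (bit_shift t)) / 2.
Proof.
have h1 : (fun k => even_bits k.+1 t) @ \oo --> even_part t.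
  by rewrite (@cvg_shiftS _ (even_bits ^~ t)); exact: even_bits_cvg.
rewrite -(cvg_lim (@Rhausdorff R) h1); apply/cvg_lim => //=.
apply: cvgD; first exact: cvg_cst.
by apply: cvgM; [exact: even_bits_cvg | exact: cvg_cst].
Qed.

Lemma even_part_bound t : 0 <= even_part t <= 1.
Proof.
apply/andP; split.
  apply: limr_ge; first by apply: cvgP; exact: even_bits_cvg.
  by near=> k; have /andP[] := even_bits_bound k t.
apply: limr_le; first by apply: cvgP; exact: even_bits_cvg.
by near=> k; have /andP[] := even_bits_bound k t.
Unshelve. all: by end_near. Qed.

Lemma measurable_bit : measurable_fun [set: TR] (bit : TR -> TR).
Proof.
apply: measurable_fun_ifT => //.
by apply: measurable_fun_ltr.
Qed.

Lemma measurable_bit_shift : measurable_fun [set: TR] (bit_shift : TR -> TR).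
Proof.
apply: measurable_funB; first exact: measurable_funM.
exact: measurable_bit.
Qed.

Lemma measurable_even_bits k : measurable_fun [set: TR] (even_bits k : TR -> TR).
Proof.
elim: k => [|k IH]; first exact: measurable_cst.
apply: measurable_funD; apply: measurable_funM => //; first exact: measurable_bit.
apply: (measurableT_comp IH); apply: measurableT_comp; exact: measurable_bit_shift.
Qed.

Lemma measurable_even_part : measurable_fun [set: TR] (even_part : TR -> TR).
Proof.
apply: (measurable_fun_cvg measurable_even_bits) => t _; exact: even_bits_cvg.
Qed.

Definition odd_part t := even_part (bit_shift t).

Lemma measurable_odd_part : measurable_fun [set: TR] (odd_part : TR -> TR).
Proof.
by apply: (measurableT_comp measurable_even_part); exact: measurable_bit_shift.
Qed.

Lemma half_branchE c t : 0 <= t < 1 -> (c = 0) \/ (c = 1) ->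
  bit (half_branch c t) = c /\ bit_shift (half_branch c t) = t.
Proof.
move=> t01 c01; rewrite /bit_shift.
have -> : bit (half_branch c t) = c.
  by rewrite /bit /half_branch; case: c01 => ->; case: ltP => //; lra.
by split => //; rewrite /half_branch; lra.
Qed.

Let F x y := pr [set t | even_part t <= x /\ odd_part t <= y].

Let mF x y : measurable ([set t | even_part t <= x /\ odd_part t <= y] : set TR).
Proof.
rewrite (_ : [set t | _] = [set: TR] `&` even_part @^-1` `]-oo, x] `&`
                           ([set: TR] `&` odd_part @^-1` `]-oo, y])); last first.
  by apply/seteqP; split => t /=; rewrite !in_itv/= => -[]; [|case => ? ? [? ?]].
by apply: measurableI; [apply: measurable_even_part|apply: measurable_odd_part].
Qed.

(* On all of R * R, this recursion is also satisfied by [K x * K y], where [K] is the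
   distribution function of the uniform law; iterating it shrinks the difference [E] to 0. *)
Let F_rec x y : F x y = 2^-1 * F y (2 * x) + 2^-1 * F y (2 * x - 1).
Proof.
(* Removing the first digit exchanges the even and the odd places, which is why [x] and [y] trade
   positions. *)
rewrite /F pr_split//; congr (_ * _ + _ * _); apply: eq_pr => t t01 /=;
  rewrite /odd_part even_part_rec.
  by have [-> ->] := half_branchE t01 (or_introl erefl); split => -[]; lra.
by have [-> ->] := half_branchE t01 (or_intror erefl); split => -[]; lra.
Qed.

Let K (x : R) : R := if x < 0 then 0 else if x < 1 then x else 1.

Let K_rec x : K x = 2^-1 * K (2 * x) + 2^-1 * K (2 * x - 1).
Proof. by rewrite /K; do ![case: ltP => ?]; lra. Qed.

Let E x y := F x y - K x * K y.

Let E_rec x y : E x y = 2^-1 * E y (2 * x) + 2^-1 * E y (2 * x - 1).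
Proof. by rewrite /E F_rec (K_rec x); ring. Qed.

Let E_neg x y : y < 0 -> E x y = 0.
Proof.
move=> y0; rewrite /E /F /K y0 mulr0 subr0 -[RHS](@pr_set0 R); apply: eq_pr => t _ /=.
by split => // -[_]; rewrite /odd_part; have := even_part_bound (bit_shift t); lra.
Qed.

Let E_ge1 x y : 1 <= x -> 1 <= y -> E x y = 0.
Proof.
move=> x1 y1; rewrite /E /F /K; do ![case: ltP => ?]; try lra.
apply/eqP; rewrite subr_eq0 mulr1; apply/eqP; rewrite -[RHS](@pr_setT R).
apply: eq_pr => t _ /=; split => // _.
by rewrite /odd_part; have := even_part_bound (bit_shift t); have := even_part_bound t; lra.
Qed.

Let E_bound x y : `|E x y| <= 1.
Proof.
have := pr_ge0 [set t | even_part t <= x /\ odd_part t <= y].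
have := pr_le1 (mF x y); rewrite -/(F x y) => F1 F0.
have k01 z : 0 <= K z <= 1 by rewrite /K; do ![case: ltP => ?]; lra.
have /andP[a0 a1] := k01 x; have /andP[b0 b1] := k01 y.
have : 0 <= K x * K y <= 1 by rewrite mulr_ge0 ?mulr_ile1.
by rewrite /E ler_norml; lra.
Qed.

Let geometric_eq0 (z : R) : (forall k, `|z| <= 2^-1 ^+ k) -> z = 0.
Proof.
move=> zk; apply/eqP; rewrite -normr_le0; apply/ler_addgt0Pl => e e0; rewrite addr0.
pose k := (Num.truncn e^-1).+1.
apply: (le_trans (zk k)); rewrite exprVn invf_ple ?posrE ?exprn_gt0//.
apply/ltW; apply: (lt_trans (truncnS_gt _)); rewrite -/k -natrX ltr_nat.
exact: ltn_expl.
Qed.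

Let E_marginal x y : 1 <= y -> E x y = 0.
Proof.
move=> y1; apply: geometric_eq0 => k; elim: k x y y1 => [|k IH] x y y1.
  by rewrite expr0 E_bound.
(* The recursion moves [y] to the first place. A second use of it brings [2 * y] and [2 * y - 1],
   both at least 1, back to the second place, where the induction hypothesis applies. *)
have key z : `|E y z| <= 2^-1 ^+ k.
  have := IH z (2 * y) ltac:(lra); have := IH z (2 * y - 1) ltac:(lra).
  by rewrite (E_rec y z) !ler_norml => ? ?; apply/andP; split; lra.
(* Only one term survives: the first vanishes if [1 <= 2 * x], the second otherwise, since then
   [2 * x - 1 < 0]. The error is thus halved. *)
rewrite E_rec exprS; have [x2|x2] := leP 1 (2 * x).
  by rewrite (E_ge1 y1 x2) mulr0 add0r normrM ger0_norm// ler_pM2l.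
by rewrite (@E_neg y (2 * x - 1)) ?mulr0 ?addr0; [rewrite normrM ger0_norm// ler_pM2l | lra].
Qed.

(** The same halving works for every [y], because [E_marginal] now removes the first term as soon as
    [1 <= 2 * x]. *)
Let E_eq0 x y : E x y = 0.
Proof.
apply: geometric_eq0 => k; elim: k x y => [|k IH] x y; first by rewrite expr0 E_bound.
rewrite E_rec exprS; have [x2|x2] := leP 1 (2 * x).
  by rewrite (E_marginal _ x2) mulr0 add0r normrM ger0_norm// ler_pM2l.
by rewrite (@E_neg y (2 * x - 1)) ?mulr0 ?addr0; [rewrite normrM ger0_norm// ler_pM2l | lra].
Qed.

Let pr_ray x : pr (`]-oo, x]%classic : set TR) = K x.
Proof.
rewrite /pr.
have -> : `]-oo, x]%classic `&` unit_itv =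
    if x < 0 then set0 else if x < 1 then `[0, x]%classic else `[0, 1[%classic :> set R.
  case: ifPn => [|]; last case: ifPn;
  by move=> *; apply/seteqP; split => t /=; rewrite /unit_itv/= !in_itv/=; lra.
rewrite /K; case: ltP => x0; first by rewrite measure0.
case: ltP => x1; rewrite lebesgue_measure_itv/= lte_fin; last by rewrite ltr01 oppr0 adde0.
case: ltP => x00; rewrite -?EFinD/= ?subr0//; lra.
Qed.

Theorem pairing_independent A B : measurable A -> measurable B ->
  pr (even_part @^-1` A `&` odd_part @^-1` B) = pr A * pr B.
Proof.
move=> mA mB.
have mE C : measurable C -> measurable (even_part @^-1` C : set TR).
  by move=> mC; rewrite -[X in measurable X]setTI; exact: measurable_even_part.
have mO C : measurable C -> measurable (odd_part @^-1` C : set TR).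
  by move=> mC; rewrite -[X in measurable X]setTI; exact: measurable_odd_part.
rewrite setIC mulrC; apply: pr_pushforward_unique => //.
- exact: measurable_even_part.
- exact: mO.
- exact: pr_ge0.
move=> x; rewrite setIC mulrC; apply: pr_pushforward_unique => //.
- exact: measurable_odd_part.
- exact: mE.
- exact: pr_ge0.
move=> y; have /eqP := E_eq0 x y; rewrite subr_eq0 !pr_ray => /eqP <-.
by apply: eq_pr => t _ /=; rewrite !in_itv.
Qed.

End pairing.

(** * Finite-valued random variables *)

Section finite_valued.
Context {R : realType}.
Notation TR := (measurableTypeR R).

(** For a finite codomain the fibres suffice, and no sigma-algebra on [Z] has to be chosen. *)
Definition fib_measurable (Z : finType) (X : R -> Z) :=
  forall z, measurable (X @^-1` [set z] : set TR).

Definition marg (Z : finType) (X : R -> Z) z : R := pr (X @^-1` [set z]).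

Definition joint (Z W : finType) (X : R -> Z) (Y : R -> W) z w : R :=
  pr (X @^-1` [set z] `&` Y @^-1` [set w]).

Definition agree (Z : finType) (X Y : R -> Z) : R := \sum_z joint X Y z z.

Lemma joint_ge0 (Z W : finType) (X : R -> Z) (Y : R -> W) z w : 0 <= joint X Y z w.
Proof. exact: pr_ge0. Qed.

Lemma jointC (Z W : finType) (X : R -> Z) (Y : R -> W) z w : joint X Y z w = joint Y X w z.
Proof. by rewrite /joint setIC. Qed.

Lemma measurable_joint (Z W : finType) (X : R -> Z) (Y : R -> W) z w :
  fib_measurable X -> fib_measurable Y ->
  measurable (X @^-1` [set z] `&` Y @^-1` [set w] : set TR).
Proof. by move=> mX mY; exact: measurableI. Qed.

(** Stated for an arbitrary measure because it serves [pr] as well as the abstract probability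
    measures at the end. *)
Lemma measure_partition d (T : measurableType d) (mu : {measure set T -> \bar R})
    (W : finType) (Y : T -> W) (E : set T) :
  (forall w, measurable (Y @^-1` [set w])) -> measurable E ->
  mu E = (\sum_w mu (E `&` Y @^-1` [set w]))%E.
Proof.
move=> mY mE.
have mEw w : measurable (E `&` Y @^-1` [set w]) by apply: measurableI.
suff key (s : seq W) : uniq s ->
    measurable (E `&` [set t | Y t \in s]) /\
    mu (E `&` [set t | Y t \in s]) = (\sum_(w <- s) mu (E `&` Y @^-1` [set w]))%E.
  have [_ /esym] := key _ (index_enum_uniq W); rewrite -/(index_enum W) => ->.
  by congr (mu _); apply/seteqP; split => t; [move=> ?; split => //=; rewrite mem_index_enum | case].
elim: s => [_|w s IH /= /andP[ws us]].
  have -> : E `&` [set t | Y t \in [::]] = set0 by apply/seteqP; split => t // [].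
  by split; [exact: measurable0 | rewrite big_nil measure0].
have [mS pS] := IH us.
have -> : E `&` [set t | Y t \in w :: s] =
    (E `&` Y @^-1` [set w]) `|` (E `&` [set t | Y t \in s]).
  rewrite -setIUr; congr (_ `&` _); apply/seteqP; split => t /=; rewrite inE.
    by move=> /orP[/eqP|]; [left|right].
  by move=> [->|->]; rewrite ?eqxx ?orbT.
split; first exact: measurableU.
rewrite big_cons -pS -measureU//.
by apply/seteqP; split => t //= -[[_ ->] [_ ws']]; rewrite ws' in ws.
Qed.

Lemma pr_partition (W : finType) (Y : R -> W) (E : set TR) : fib_measurable Y ->
  measurable E -> pr E = \sum_w pr (E `&` Y @^-1` [set w]).
Proof.
move=> mY mE; apply: EFin_inj; rewrite -pr_fin//.
rewrite (@measure_partition _ TR (@lebesgue_measure R) W Y)//; last first.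
  by apply: measurableI => //; exact: measurable_unit_itv.
rewrite -sumEFin; apply: eq_bigr => w _.
by rewrite -pr_fin 1?setIAC//; apply: measurableI => //; exact: (mY w).
Qed.

Lemma sum_joint (Z W : finType) (X : R -> Z) (Y : R -> W) z :
  fib_measurable X -> fib_measurable Y -> \sum_w joint X Y z w = marg X z.
Proof. by move=> mX mY; rewrite /marg (pr_partition mY). Qed.

Lemma sum_marg (Z : finType) (X : R -> Z) : fib_measurable X -> \sum_z marg X z = 1.
Proof.
move=> mX; rewrite -(@pr_setT R) (pr_partition mX)//.
by apply: eq_bigr => z _; rewrite setTI.
Qed.

Lemma joint_lel (Z W : finType) (X : R -> Z) (Y : R -> W) z w :
  fib_measurable X -> fib_measurable Y -> joint X Y z w <= marg X z.
Proof. by move=> mX mY; apply: le_pr => //; exact: measurableI. Qed.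

Lemma joint_ler (Z W : finType) (X : R -> Z) (Y : R -> W) z w :
  fib_measurable X -> fib_measurable Y -> joint X Y z w <= marg Y w.
Proof. by move=> mX mY; rewrite jointC joint_lel. Qed.

Lemma fib_measurable_cst (Z : finType) (z : Z) : fib_measurable (fun=> z).
Proof.
move=> w; rewrite (_ : _ @^-1` _ = if z == w then setT else set0).
  by case: ifP => _; [exact: measurableT | exact: measurable0].
by apply/seteqP; split => t /=; case: eqP.
Qed.

Lemma marg_cst (Z : finType) (z w : Z) : marg (fun=> z) w = (z == w)%:R.
Proof.
rewrite /marg (_ : _ @^-1` _ = if z == w then setT else set0).
  by case: ifP => _; [exact: pr_setT | exact: pr_set0].
by apply/seteqP; split => t /=; case: eqP.
Qed.

Lemma joint_cst (Z : finType) (z : Z) : joint (fun=> z) (fun=> z) z z = 1.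
Proof.
rewrite /joint (_ : _ `&` _ = setT) ?pr_setT//.
by apply/seteqP; split => t //=.
Qed.

(* [mix Y W] runs [W z] on randomness independent of [Y], where [z] is the outcome of [Y]. *)
Definition mix (Z V : finType) (Y : R -> Z) (W : Z -> R -> V) (t : R) : V :=
  W (Y (even_part t)) (odd_part t).

Lemma measurable_even_preimage (A : set TR) : measurable A ->
  measurable (even_part @^-1` A : set TR).
Proof. by move=> mA; rewrite -[X in measurable X]setTI; exact: measurable_even_part. Qed.

Lemma measurable_odd_preimage (A : set TR) : measurable A ->
  measurable (odd_part @^-1` A : set TR).
Proof. by move=> mA; rewrite -[X in measurable X]setTI; exact: measurable_odd_part. Qed.

Lemma fib_measurable_mix (Z V : finType) (Y : R -> Z) (W : Z -> R -> V) :
  fib_measurable Y -> (forall z, fib_measurable (W z)) -> fib_measurable (mix Y W).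
Proof.
move=> mY mW v.
have -> : mix Y W @^-1` [set v] = \bigcup_(z in [set: Z])
    (even_part @^-1` (Y @^-1` [set z]) `&` odd_part @^-1` (W z @^-1` [set v])).
  apply/seteqP; split => t /=; first by move=> <-; exists (Y (even_part t)).
  by move=> [z _ [/= Yz Wv]]; rewrite /mix Yz.
apply: (@fin_bigcup_measurable _ TR) => [|z _]; first exact: finite_finset.
apply: measurableI; first exact: measurable_even_preimage.
by apply: measurable_odd_preimage; exact: mW.
Qed.

(** Both first stages read the even digits and both second stages the odd ones, so
    [pairing_independent] factors each term. *)
Lemma joint_mix (Z Z' V V' : finType) (Y : R -> Z) (W : Z -> R -> V)
    (Y' : R -> Z') (W' : Z' -> R -> V') v v' :
  fib_measurable Y -> (forall z, fib_measurable (W z)) ->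
  fib_measurable Y' -> (forall z, fib_measurable (W' z)) ->
  joint (mix Y W) (mix Y' W') v v' =
  \sum_z \sum_z' joint Y Y' z z' * joint (W z) (W' z') v v'.
Proof.
move=> mY mW mY' mW'; rewrite /joint.
have mE : measurable ((mix Y W @^-1` [set v] `&` mix Y' W' @^-1` [set v']) : set TR).
  exact: (measurable_joint v v' (fib_measurable_mix mY mW) (fib_measurable_mix mY' mW')).
have mYe : fib_measurable (Y \o even_part) by move=> y; exact: (measurable_even_preimage (mY y)).
have mYe' : fib_measurable (Y' \o even_part) by move=> y; exact: (measurable_even_preimage (mY' y)).
rewrite (pr_partition mYe)//; apply: eq_bigr => z _.
rewrite (pr_partition mYe'); last by apply: (@measurableI _ TR); [exact: mE|exact: (mYe z)].
apply: eq_bigr => z' _; rewrite -pairing_independent.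
- congr pr; apply/seteqP; split => t /=; rewrite /mix.
    by move=> [[[Wv Wv'] Yz] Yz']; rewrite Yz in Wv; rewrite Yz' in Wv'.
  by move=> [[Yz Yz'] [Wv Wv']]; rewrite Yz Yz'.
- exact: (measurable_joint z z' mY mY').
- exact: (measurable_joint v v' (mW z) (mW' z')).
Qed.

Lemma marg_mix (Z V : finType) (Y : R -> Z) (W : Z -> R -> V) v :
  fib_measurable Y -> (forall z, fib_measurable (W z)) ->
  marg (mix Y W) v = \sum_z marg Y z * marg (W z) v.
Proof.
move=> mY mW; have mM := fib_measurable_mix mY mW.
rewrite -(sum_joint v mM mM).
under eq_bigr do rewrite joint_mix//.
rewrite exchange_big/=; apply: eq_bigr => z _.
rewrite exchange_big/= -(sum_joint z mY mY) mulr_suml; apply: eq_bigr => z' _.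
by rewrite -mulr_sumr sum_joint.
Qed.

(** [None] stands for the points outside all the intervals. Under [itv_disjoint] the choice made by
    [pick] is forced. *)
Definition itv_select (Z : finType) (a b : Z -> R) (t : R) : option Z :=
  [pick z | a z <= t < b z].

Definition itv_disjoint (Z : finType) (a b : Z -> R) :=
  forall z w t, a z <= t < b z -> a w <= t < b w -> z = w.

Lemma itv_select_preimage (Z : finType) (a b : Z -> R) z : itv_disjoint a b ->
  itv_select a b @^-1` [set Some z] = `[a z, b z[%classic.
Proof.
move=> dis; apply/seteqP; split => t /=; rewrite /itv_select in_itv/=; case: pickP => //=.
- by move=> w tw [<-].
- by move=> w tw tz; rewrite (dis _ _ _ tw tz).
- by move=> none tz; rewrite none in tz.
Qed.

Lemma fib_measurable_itv_select (Z : finType) (a b : Z -> R) : itv_disjoint a b ->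
  fib_measurable (itv_select a b).
Proof.
move=> dis [z|]; first by rewrite itv_select_preimage//; exact: measurable_itv.
have -> : itv_select a b @^-1` [set None] = ~` \bigcup_(z in [set: Z]) `[a z, b z[%classic.
  apply/seteqP; split => t /=; rewrite /itv_select; case: pickP => //=.
    by move=> none _ [z _ /=]; rewrite in_itv/= none.
  by move=> z tz nt; exfalso; apply: nt; exists z => //=; rewrite in_itv.
apply: measurableC; apply: (@fin_bigcup_measurable _ TR) => [|z _].
  exact: finite_finset.
exact: measurable_itv.
Qed.

Lemma pr_itv (a b : R) : 0 <= a -> a <= b -> b <= 1 -> pr `[a, b[%classic = b - a.
Proof.
move=> a0 ab b1; rewrite /pr (_ : _ `&` _ = `[a, b[%classic).
  by rewrite lebesgue_measure_itv/= lte_fin; case: ltP => //= ?; rewrite /=; lra.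
by apply/seteqP; split => t /=; rewrite /unit_itv/= !in_itv/=; [case | move=> ?; split]; lra.
Qed.

Lemma marg_itv_select (Z : finType) (a b : Z -> R) z : itv_disjoint a b ->
  0 <= a z -> a z <= b z -> b z <= 1 -> marg (itv_select a b) (Some z) = b z - a z.
Proof. by move=> dis a0 ab b1; rewrite /marg itv_select_preimage// pr_itv. Qed.

Lemma joint_itv_select_ge (Z : finType) (a b a' b' : Z -> R) z :
  itv_disjoint a b -> itv_disjoint a' b' ->
  0 <= a z -> b z <= 1 ->
  Num.min (b z) (b' z) - Num.max (a z) (a' z) <=
  joint (itv_select a b) (itv_select a' b') (Some z) (Some z).
Proof.
move=> dis dis' a0 b1.
have [lt|ge] := ltP (Num.max (a z) (a' z)) (Num.min (b z) (b' z)); last first.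
  by apply: le_trans (joint_ge0 _ _ _ _); rewrite subr_le0.
rewrite /joint !itv_select_preimage//.
rewrite (_ : _ `&` _ = `[Num.max (a z) (a' z), Num.min (b z) (b' z)[%classic); last first.
  apply/seteqP; split => t /=; rewrite !in_itv/= ge_max lt_min.
    by move=> [/andP[-> ->] /andP[-> ->]].
  by move=> /andP[/andP[-> ->] /andP[-> ->]].
rewrite pr_itv//; first by rewrite le_max a0.
  exact: ltW.
by rewrite ge_min b1.
Qed.

Definition is_prob (Z : finType) (mu : Z -> R) :=
  (forall z, 0 <= mu z) /\ \sum_z mu z = 1.

Definition dist1 (Z : finType) (mu nu : Z -> R) := \sum_z `|mu z - nu z|.

Lemma agree_le1 (Z : finType) (X Y : R -> Z) : fib_measurable X -> fib_measurable Y ->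
  agree X Y <= 1.
Proof.
move=> mX mY; rewrite -(sum_marg mX); apply: ler_sum => z _; exact: joint_lel.
Qed.

(** Both families sum to 1, so the nonnegative differences sum to 0. *)
Lemma eq_marg (Z : finType) (X : R -> Z) (mu : Z -> R) : fib_measurable X ->
  is_prob mu -> (forall z, mu z <= marg X z) -> forall z, marg X z = mu z.
Proof.
move=> mX [mu0 mu1] le z; apply/eqP; rewrite -subr_eq0.
have : \sum_z (marg X z - mu z) == 0 by rewrite sumrB sum_marg// mu1 subrr.
rewrite psumr_eq0 => [/allP/(_ z)|w _]; last by rewrite subr_ge0.
by rewrite mem_index_enum => /(_ isT).
Qed.

End finite_valued.

(** * Correlated sampling *)

Section sampler.
Context {R : realType} (Z : finType) (z0 : Z).
Implicit Types mu nu : Z -> R.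

(** One map [G] treats all laws on the same randomness; this is what couples them simultaneously. *)
Definition is_sampler (G : (Z -> R) -> R -> Z) :=
  forall mu, is_prob mu -> fib_measurable (G mu) /\ forall z, marg (G mu) z = mu z.

Lemma dist1_ge0 mu nu : 0 <= dist1 mu nu.
Proof. by apply: sumr_ge0 => z _. Qed.

Definition cum mu (z : Z) : R := \sum_(w : Z | (enum_rank w < enum_rank z)%N) mu w.

Lemma cum_add_le mu (z w : Z) : (forall z, 0 <= mu z) -> (enum_rank z < enum_rank w)%N ->
  cum mu z + mu z <= cum mu w.
Proof.
move=> mu0 zw; rewrite /cum [leRHS](bigD1 z)//= [leLHS]addrC lerD2l.
rewrite [leLHS]big_mkcond [leRHS]big_mkcond; apply: ler_sum => v _.
case: ifPn => [vz|_]; last by case: ifP.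
by rewrite (ltn_trans vz zw)/= ifT//; apply: contraTneq vz => ->; rewrite ltnn.
Qed.

Lemma cum_ge0 mu z : (forall z, 0 <= mu z) -> 0 <= cum mu z.
Proof. by move=> mu0; apply: sumr_ge0 => w _. Qed.

Lemma cum_add_le1 mu z : is_prob mu -> cum mu z + mu z <= 1.
Proof.
move=> [mu0 <-]; rewrite [leRHS](bigD1 z)//= [leLHS]addrC lerD2l /cum.
rewrite [leLHS]big_mkcond [leRHS]big_mkcond; apply: ler_sum => v _.
case: ifPn => [vz|_]; last by case: ifP.
by rewrite ifT//; apply: contraTneq vz => ->; rewrite ltnn.
Qed.

Lemma cum_disjoint mu : (forall z, 0 <= mu z) ->
  itv_disjoint (cum mu) (fun z => cum mu z + mu z).
Proof.
move=> mu0 z w t tz tw; apply: enum_rank_inj; apply: val_inj => /=.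
case: (ssrnat.ltngtP (enum_rank z) (enum_rank w)) => // /(cum_add_le mu0) ?; exfalso; lra.
Qed.

Lemma cum_dist mu nu z : `|cum mu z - cum nu z| <= dist1 mu nu.
Proof.
rewrite /cum -sumrB; apply: (le_trans (ler_norm_sum _ _ _)).
by rewrite [leLHS]big_mkcond; apply: ler_sum => w _; case: ifP.
Qed.

(** The right endpoint is itself a partial sum, with [z] included, so it moves no more than the left
    one. *)
Lemma cum_add_dist mu nu z :
  `|(cum mu z + mu z) - (cum nu z + nu z)| <= dist1 mu nu.
Proof.
have E m : cum m z + m z = \sum_(w : Z | (enum_rank w <= enum_rank z)%N) m w.
  rewrite (bigD1 z)//= addrC; congr (_ + _); apply: eq_bigl => w.
  by rewrite ltn_neqAle andbC -(inj_eq enum_rank_inj).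
rewrite !E -sumrB; apply: (le_trans (ler_norm_sum _ _ _)).
by rewrite [leLHS]big_mkcond; apply: ler_sum => w _; case: ifP.
Qed.

(** Inversion of the distribution function. Both ends of the interval of [z] move by at most
    [dist1 mu nu], so each [z] loses at most twice that. This crude constant only starts the
    iteration of [rejection_round]. *)
Lemma cdf_sampler_exists : exists G, is_sampler G /\
  forall mu nu, is_prob mu -> is_prob nu ->
    1 - agree (G mu) (G nu) <= 2 * #|Z|%:R * dist1 mu nu.
Proof.
pose S mu := itv_select (cum mu) (fun z => cum mu z + mu z).
pose G mu t := odflt z0 (S mu t).
have mS mu : is_prob mu -> fib_measurable (S mu).
  by move=> [mu0 _]; exact: (fib_measurable_itv_select (cum_disjoint mu0)).
have GS mu z t : S mu t = Some z -> G mu t = z by rewrite /G => ->.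
have mG mu : is_prob mu -> fib_measurable (G mu).
  move=> muP z; rewrite (_ : _ @^-1` _ = S mu @^-1` [set Some z] `|`
      (if z == z0 then S mu @^-1` [set None] else set0)).
    apply: measurableU; first exact: (mS _ muP).
    by case: ifP => _; [exact: (mS _ muP) | exact: measurable0].
  apply/seteqP; split => t /=; rewrite /G; case E: (S mu t) => [w|] /=.
  - by move=> ->; left.
  - by move=> <-; right; rewrite eqxx.
  - by case=> [[]//|]; case: ifP => //=; rewrite E.
  - by case=> //; case: eqP.
have leG mu nu z : is_prob mu -> is_prob nu ->
    joint (S mu) (S nu) (Some z) (Some z) <= joint (G mu) (G nu) z z.
  move=> muP nuP; apply: le_pr; [exact: (measurable_joint _ _ (mS _ muP) (mS _ nuP))
    | exact: (measurable_joint _ _ (mG _ muP) (mG _ nuP)) |].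
  by move=> t [/= /GS-> /GS->].
exists G; split.
  move=> mu muP; split; first exact: mG.
  (* The default [z0] can only add mass, so one inequality is enough. *)
  apply: eq_marg => //; first exact: mG.
  move=> z; have [mu0 mu1] := muP.
  have <- : marg (S mu) (Some z) = mu z.
    have le : cum mu z <= cum mu z + mu z by rewrite lerDl.
    rewrite (marg_itv_select (cum_disjoint mu0) (cum_ge0 z mu0) le (cum_add_le1 z muP)).
    by rewrite addrAC subrr add0r.
  apply: le_pr => [||t /= /GS//]; [exact: (mS _ muP) | exact: (mG _ muP)].
move=> mu nu muP nuP.
have [mu0 mu1] := muP; have [nu0 nu1] := nuP.
have key z : mu z - 2 * dist1 mu nu <= joint (G mu) (G nu) z z.
  apply: le_trans (leG _ _ _ muP nuP).
  apply: le_trans (joint_itv_select_ge (cum_disjoint mu0) (cum_disjoint nu0)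
      (cum_ge0 z mu0) (cum_add_le1 z muP)).
  - have := cum_dist mu nu z; have := cum_add_dist mu nu z.
    rewrite !ler_norml => /andP[? ?] /andP[? ?].
    by rewrite /Num.min /Num.max; do 2 case: ifP => _; lra.
have : \sum_z (mu z - 2 * dist1 mu nu) <= agree (G mu) (G nu).
  by apply: ler_sum => z _; exact: key.
rewrite sumrB mu1 sumr_const => h.
by rewrite -mulrA [X in 2 * X]mulrC mulrA mulr_natr; lra.
Qed.

Let N : R := #|Z|%:R.

Let N_gt0 : 0 < N.
Proof. by rewrite ltr0n; apply/card_gt0P; exists z0. Qed.

(** Left end of the slot of [z] among [N] equal slots of [[0, 1)]. The slot hit by [t] is the
    uniform proposal, and it is accepted when [t] lies in its initial fraction [mu z]; a single
    uniform variable thus does both. *)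
Definition slot (z : Z) : R := (enum_rank z)%:R / N.

Lemma slotS_le (z w : Z) : (enum_rank z < enum_rank w)%N -> slot z + N^-1 <= slot w.
Proof.
by move=> zw; rewrite /slot -{2}[N^-1]mul1r -mulrDl ler_pM2r ?invr_gt0// natr1 ler_nat.
Qed.

Lemma slot_disjoint mu nu z w t : (forall z, mu z <= 1) -> (forall z, nu z <= 1) ->
  slot z <= t < slot z + mu z / N -> slot w <= t < slot w + nu w / N -> z = w.
Proof.
move=> mu1 nu1 tz tw; apply: enum_rank_inj; apply: val_inj => /=.
have lez m (v : Z) : (forall z, m z <= 1) -> m v / N <= N^-1.
  by move=> m1; apply: ler_piMl; [rewrite invr_ge0 ltW | exact: m1].
have := lez mu z mu1; have := lez nu w nu1.
by case: (ssrnat.ltngtP (enum_rank z) (enum_rank w)) => // /slotS_le ? ? ?; exfalso; lra.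
Qed.

(* One round of rejection sampling followed by [G].  Shared proposals are accepted for only
   one of [mu] and [nu] with probability [N^-1 * dist1 mu nu], which contracts [C] towards 1. *)
Lemma rejection_round G C : is_sampler G ->
  (forall mu nu, is_prob mu -> is_prob nu -> 1 - agree (G mu) (G nu) <= C * dist1 mu nu) ->
  exists G', is_sampler G' /\
  forall mu nu, is_prob mu -> is_prob nu ->
    1 - agree (G' mu) (G' nu) <= (N^-1 + (1 - N^-1) * C) * dist1 mu nu.
Proof.
move=> sG GC.
have N1 : N^-1 <= 1 by rewrite invf_le1// ler1n; apply/card_gt0P; exists z0.
pose Y mu := itv_select slot (fun z => slot z + mu z / N).
(* [None] means rejection: [G] is then run on fresh randomness. *)
pose W mu (o : option Z) := if o is Some z then fun=> z else G mu.
pose G' mu := mix (Y mu) (W mu).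
have le1 mu z : is_prob mu -> mu z <= 1.
  by move=> [mu0 <-]; rewrite (bigD1 z)//= lerDl sumr_ge0.
have disY mu : is_prob mu -> itv_disjoint slot (fun z => slot z + mu z / N).
  by move=> muP z w t; apply: slot_disjoint => v; exact: le1.
have mY mu : is_prob mu -> fib_measurable (Y mu).
  by move=> muP; exact: (fib_measurable_itv_select (disY _ muP)).
have mW mu : is_prob mu -> forall o, fib_measurable (W mu o).
  by move=> muP [z|] /=; [exact (fib_measurable_cst z) | exact (sG _ muP).1].
have slot0 z : 0 <= slot z by rewrite /slot divr_ge0// ltW.
have slot1 mu z : is_prob mu -> slot z + mu z / N <= 1.
  move=> muP; apply: (@le_trans _ _ (slot z + N^-1)).
    by rewrite lerD2l; apply: ler_piMl; [rewrite invr_ge0 ltW | exact: le1].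
  rewrite /slot -{2}[N^-1]mul1r -mulrDl ler_pdivrMr// mul1r natr1 ler_nat.
  exact: ltn_ord.
have YS mu z : is_prob mu -> marg (Y mu) (Some z) = mu z / N.
  move=> muP; have le : slot z <= slot z + mu z / N.
    by rewrite lerDl divr_ge0 ?(ltW N_gt0)//; case: muP.
  rewrite (marg_itv_select (disY _ muP) (slot0 z) le (slot1 _ _ muP)).
  by rewrite addrAC subrr add0r.
have sumo (f : option Z -> R) : \sum_o f o = f None + \sum_z f (Some z).
  rewrite (bigD1 None)//=; congr (_ + _).
  rewrite (reindex_omap Some id)/=; last by case.
  by apply: eq_bigl => z; rewrite eqxx.
have YN mu : is_prob mu -> marg (Y mu) None = 1 - N^-1.
  move=> muP; have := sum_marg (mY _ muP); rewrite sumo.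
  under eq_bigr do rewrite (YS _ _ muP).
  by rewrite -mulr_suml muP.2; lra.
exists G'; split.
  move=> mu muP; split; first exact: fib_measurable_mix (mY _ muP) (mW _ muP).
  move=> z; rewrite (marg_mix _ (mY _ muP) (mW _ muP)) sumo YN// (sG _ muP).2.
  rewrite (bigD1 z)//= YS// marg_cst eqxx big1 => [|w /negPf wz]; last first.
    by rewrite marg_cst wz mulr0.
  by rewrite mulr1 addr0 mulrBl mul1r [N^-1 * _]mulrC subrK.
move=> mu nu muP nuP.
pose J := joint (Y mu) (Y nu).
pose A := \sum_z J (Some z) (Some z).
(* The outcomes agree if the same proposal is accepted twice, or if both laws reject and [G] agrees
   afterwards. *)
have ag : A + J None None * agree (G mu) (G nu) <= agree (G' mu) (G' nu).
  have E : A + J None None * agree (G mu) (G nu) =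
      \sum_z (J (Some z) (Some z) + J None None * joint (G mu) (G nu) z z).
    by rewrite big_split/= -mulr_sumr.
  rewrite E; apply: ler_sum => z _.
  rewrite (joint_mix _ _ (mY _ muP) (mW _ muP) (mY _ nuP) (mW _ nuP)).
  have Jge0 o o' : 0 <= J o o' * joint (W mu o) (W nu o') z z.
    by rewrite mulr_ge0// joint_ge0.
  rewrite sumo addrC; apply: lerD.
    by rewrite (bigD1 None)//= lerDl sumr_ge0.
  apply: (@le_trans _ _ (\sum_z' J (Some z) z' * joint (W mu (Some z)) (W nu z') z z)).
    rewrite (bigD1 (Some z))//= joint_cst mulr1 lerDl; apply: sumr_ge0 => o _.
    exact: (Jge0 (Some z) o).
  rewrite [leRHS](bigD1 z)//= lerDl; apply: sumr_ge0 => w _; apply: sumr_ge0 => o _.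
  exact: Jge0.
have N0 := ltW N_gt0.
have Amin : (1 - dist1 mu nu / 2) / N <= A.
  (* The last term sums to 0; it makes each summand equal to [Num.min (mu z) (nu z) / N]. *)
  have -> : (1 - dist1 mu nu / 2) / N = \sum_z (mu z / N - `|mu z - nu z| / 2 / N - (mu z - nu z) / 2 / N).
    rewrite !sumrB -!mulr_suml sumrB muP.2 nuP.2 subrr !mul0r subr0 /dist1; ring.
  apply: ler_sum => z _.
  apply: le_trans (joint_itv_select_ge (disY _ muP) (disY _ nuP) (slot0 z) (slot1 _ _ muP)).
  rewrite -!mulrBl maxxx.
  have -> : Num.min (slot z + mu z / N) (slot z + nu z / N) = slot z + Num.min (mu z) (nu z) / N.
    rewrite /Num.min ltrD2l ltr_pM2r ?invr_gt0//; case: ifP => //.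
  rewrite [leRHS]addrAC subrr add0r ler_pM2r ?invr_gt0//.
  by rewrite /Num.min; case: ltP => ?; [rewrite ler0_norm; lra|rewrite ger0_norm; lra].
(* Inclusion-exclusion: each law accepts with probability [N^-1], and both accept with probability
   at least [A]. *)
have JNN : 1 - 2 / N + A <= J None None.
  have e1 := sum_joint None (mY _ muP) (mY _ nuP).
  rewrite sumo YN// -/J in e1.
  have e2 : \sum_z J None (Some z) <= N^-1 - A.
    have -> : N^-1 = \sum_z marg (Y nu) (Some z).
      by under eq_bigr do rewrite YS//; rewrite -mulr_suml nuP.2 mul1r.
    rewrite /A -sumrB; apply: ler_sum => z _.
    rewrite -(sum_joint (Some z) (mY _ nuP) (mY _ muP)) sumo (bigD1 z)//=.
    rewrite [joint _ _ _ None]jointC [joint (Y nu) _ (Some z) (Some z)]jointC -/J.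
    have : 0 <= \sum_(i | i != z) joint (Y nu) (Y mu) (Some z) (Some i).
      by apply: sumr_ge0 => w _; exact: joint_ge0.
    by lra.
  lra.
have JN1 : J None None <= 1 - N^-1.
  by rewrite -(YN _ muP); apply: joint_lel; [exact: mY|exact: mY].
have sep := GC _ _ muP nuP.
have sep0 : 0 <= 1 - agree (G mu) (G nu).
  by rewrite subr_ge0 agree_le1//; [exact: (sG _ muP).1|exact: (sG _ nuP).1].
have h1 : J None None * (1 - agree (G mu) (G nu)) <= (1 - N^-1) * (C * dist1 mu nu).
  by apply: ler_pM => //; exact: joint_ge0.
(* By [JNN] and [Amin], [1 - A - J None None] is at most [2 / N - 2 * A], hence at most
   [N^-1 * dist1 mu nu]; [h1] bounds the disagreement after a double rejection. *)
rewrite mulrDl -(mulrA (1 - N^-1)).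
move: Amin; rewrite mulrBl mul1r -mulrA => Amin.
have e3 : dist1 mu nu * (2^-1 / N) = N^-1 * dist1 mu nu / 2 by ring.
move: Amin h1; rewrite e3 mulrBr mulr1.
set u := N^-1 * dist1 _ _; set v := J None None * agree _ _ in ag *.
set w := (1 - N^-1) * _; lra.
Qed.

(** A round maps [C] to [N^-1 + (1 - N^-1) * C], which has fixed point 1 and ratio [1 - N^-1];
    finitely many rounds bring the constant of [cdf_sampler_exists] below [1 + eps]. *)
Lemma correlated_sampling eps : 0 < eps -> exists G, is_sampler G /\
  forall mu nu, is_prob mu -> is_prob nu ->
    1 - agree (G mu) (G nu) <= (1 + eps) * dist1 mu nu.
Proof.
move=> e0.
have N1 : N^-1 <= 1 by rewrite invf_le1// ler1n; apply/card_gt0P; exists z0.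
pose r := 1 - N^-1.
have r01 : 0 <= r < 1 by rewrite /r subr_ge0 N1 ltrBlDr ltrDl invr_gt0.
have [k hk] : exists k, r ^+ k * (2 * N) <= eps.
  have : (fun k => r ^+ k) @ \oo --> (0 : R).
    by apply: cvg_expr; rewrite ger0_norm; case/andP: r01.
  move=> /cvgrPdist_le /(_ (eps / (2 * N))) [|k _ /(_ k (leqnn k))].
    by rewrite divr_gt0// mulr_gt0.
  rewrite sub0r normrN ger0_norm ?exprn_ge0 ?(andP r01).1// => h.
  by exists k; rewrite -ler_pdivlMr// mulr_gt0.
have [G [sG hG]] : exists G, is_sampler G /\ forall mu nu, is_prob mu -> is_prob nu ->
    1 - agree (G mu) (G nu) <= (1 + r ^+ k * (2 * N)) * dist1 mu nu.
  elim: k {hk} => [|k [G [sG hG]]].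
    have [G [sG hG]] := cdf_sampler_exists; exists G; split=> // mu nu muP nuP.
    apply: (le_trans (hG _ _ muP nuP)); rewrite expr0 mul1r ler_wpM2r ?dist1_ge0//.
    by rewrite lerDr.
  have [G' [sG' hG']] := rejection_round sG hG; exists G'; split=> // mu nu muP nuP.
  apply: (le_trans (hG' _ _ muP nuP)); rewrite ler_wpM2r ?dist1_ge0//.
  by rewrite -/r exprS /r; lra.
exists G; split=> // mu nu muP nuP; apply: (le_trans (hG _ _ muP nuP)).
by rewrite ler_wpM2r ?dist1_ge0// lerD2l.
Qed.

End sampler.

(** * The hierarchical sampler *)

Section tree.
Context {R : realType} (V Z : finType) (v0 : V) (z0 : Z).
Variables (d : V -> V -> R).
Hypotheses (d_ge0 : forall x y, 0 <= d x y) (d_refl : forall x, d x x = 0).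
Implicit Types (P Q : V -> R) (f : V -> Z -> R) (D : R).

Definition mass P : R := \sum_v P v.

(* Junk value: the null weight is normalized to a point mass, so that [normalize P] is a
   probability for every nonnegative [P]. *)
Definition normalize P : V -> R :=
  if mass P == 0 then fun v => (v == v0)%:R else fun v => P v / mass P.

Definition push f P z : R := \sum_v P v * f v z.

(** The posterior of the input given the output [z], left unnormalized. *)
Definition slice f z P v : R := P v * f v z.

Definition mean_dist (X Y : R -> V) : R := \sum_v \sum_w joint X Y v w * d v w.

Definition supports_close D P Q := forall x y, 0 < P x -> 0 < Q y -> d x y <= D.

Definition channel D f :=
  [/\ 0 <= D, (forall v z, 0 <= f v z), (forall v, \sum_z f v z = 1) &
      forall x y z, 0 < f x z -> 0 < f y z -> d x y <= D].

(** Bounds the cost of the hierarchical sampler on weights of any mass, so that a level is a plain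
    sum over slices. The difference of masses pays for normalizing, as in [dist1_normalized]. *)
Fixpoint tree_cost (l : seq (R * (V -> Z -> R))) D P Q : R :=
  if l is (D', f) :: l' then
    D * (dist1 (push f P) (push f Q) + `|mass P - mass Q|) +
    \sum_z tree_cost l' D' (slice f z P) (slice f z Q)
  else D * (dist1 P Q + `|mass P - mass Q|).

Fixpoint channels (l : seq (R * (V -> Z -> R))) : Prop :=
  if l is (D, f) :: l' then channel D f /\ channels l' else True.

Lemma mass_slice f z P : mass (slice f z P) = push f P z.
Proof. by []. Qed.

Lemma mass_ge0 P : (forall v, 0 <= P v) -> 0 <= mass P.
Proof. by move=> P0; apply: sumr_ge0. Qed.

Lemma normalize_prob P : (forall v, 0 <= P v) -> is_prob (normalize P).
Proof.
move=> P0; rewrite /normalize; case: eqP => [_|/eqP tP]; split.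
- by move=> v; rewrite ler0n.
- by rewrite (bigD1 v0)//= eqxx big1 ?addr0// => v /negPf ->.
- by move=> v; rewrite divr_ge0// mass_ge0.
- by rewrite -mulr_suml divff.
Qed.

Lemma normalize_id P : is_prob P -> normalize P = P.
Proof.
move=> [P0 P1]; rewrite /normalize {1}/mass P1 oner_eq0; apply/funext => v.
by rewrite /mass P1 divr1.
Qed.

Lemma normalize_scale P c : 0 < c -> normalize (fun v => P v / c) = normalize P.
Proof.
move=> c0; have tE : mass (fun v => P v / c) = mass P / c by rewrite /mass mulr_suml.
rewrite /normalize tE mulf_eq0 invr_eq0 (gt_eqF c0) orbF; case: eqP => // /eqP tP.
by apply/funext => v; field; rewrite tP gt_eqF.
Qed.

Lemma normalize_gt0 P v : (forall v, 0 <= P v) -> 0 < mass P -> 0 < normalize P v -> 0 < P v.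
Proof.
by move=> P0 tP; rewrite /normalize gt_eqF// pmulr_lgt0// invr_gt0.
Qed.

Lemma push_ge0 f P z : (forall v, 0 <= P v) -> (forall v z, 0 <= f v z) -> 0 <= push f P z.
Proof. by move=> P0 f0; apply: sumr_ge0 => v _; rewrite mulr_ge0. Qed.

Lemma sum_push f P : (forall v, \sum_z f v z = 1) -> \sum_z push f P z = mass P.
Proof.
move=> f1; rewrite /push exchange_big/=; apply: eq_bigr => v _.
by rewrite -mulr_sumr f1 mulr1.
Qed.

Lemma push_prob f P : (forall v z, 0 <= f v z) -> (forall v, \sum_z f v z = 1) ->
  is_prob P -> is_prob (push f P).
Proof.
move=> f0 f1 [P0 P1]; split; first by move=> z; exact: push_ge0.
by rewrite sum_push.
Qed.

Lemma tree_cost_ge0 l D P Q : channels l -> 0 <= D -> 0 <= tree_cost l D P Q.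
Proof.
elim: l D P Q => [|[D' f] l IH] D P Q /=.
  by move=> _ D0; rewrite mulr_ge0// addr_ge0// dist1_ge0.
move=> [[D'0 _ _ _] cl] D0; rewrite addr_ge0 ?mulr_ge0 ?addr_ge0 ?dist1_ge0//.
by apply: sumr_ge0 => z _; exact: IH.
Qed.

(** If [a <= b], multiplying by [a] leaves [p] and turns [q] into [q * a / b], a decrease of total
    mass [b - a]. *)
Lemma dist1_normalized (W : finType) (a b : R) (p q : W -> R) : 0 < a -> 0 < b ->
  (forall w, 0 <= p w) -> (forall w, 0 <= q w) ->
  \sum_w p w = a -> \sum_w q w = b ->
  Num.min a b * dist1 (fun w => p w / a) (fun w => q w / b) <= dist1 p q + `|a - b|.
Proof.
have wlog_le (a' b' : R) (p' q' : W -> R) : 0 < a' -> 0 < b' -> a' <= b' ->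
    (forall w, 0 <= q' w) -> \sum_w q' w = b' ->
    a' * dist1 (fun w => p' w / a') (fun w => q' w / b') <= dist1 p' q' + (b' - a').
  move=> a0 b0 ab q0 qb; rewrite /dist1.
  have -> : b' - a' = \sum_w q' w * (1 - a' / b').
    by rewrite -mulr_suml qb; field; rewrite gt_eqF.
  rewrite mulr_sumr -big_split/=; apply: ler_sum => w _.
  rewrite -{1}(gtr0_norm a0) -normrM.
  have -> : a' * (p' w / a' - q' w / b') = (p' w - q' w) + q' w * (1 - a' / b').
    by field; rewrite !gt_eqF.
  apply: (le_trans (ler_normD _ _)); rewrite lerD2l ger0_norm// mulr_ge0//.
  by rewrite subr_ge0 ler_pdivrMr// mul1r.
move=> a0 b0 p0 q0 pa qb; have [ab|/ltW ba] := leP a b.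
  by rewrite ler0_norm ?subr_le0// opprB; exact: wlog_le.
rewrite ger0_norm ?subr_ge0//.
have dC (u v : W -> R) : dist1 u v = dist1 v u.
  by apply: eq_bigr => w _; rewrite distrC.
by rewrite dC (dC p); exact: wlog_le.
Qed.

Lemma mean_dist_le D (X Y : R -> V) : 0 <= D ->
  fib_measurable X -> fib_measurable Y ->
  (forall v w, 0 < marg X v -> 0 < marg Y w -> d v w <= D) ->
  mean_dist X Y <= D * (1 - agree X Y).
Proof.
move=> D0 mX mY dD.
have -> : D * (1 - agree X Y) = \sum_v \sum_w joint X Y v w * (D * (v != w)%:R).
  rewrite /agree -[X in D * (X - _)](sum_marg mX) -sumrB mulr_sumr; apply: eq_bigr => v _.
  rewrite -(sum_joint v mX mY) [in RHS](bigD1 v)//= eqxx/= !mulr0 add0r.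
  rewrite (bigD1 v)//= addrAC subrr add0r mulr_sumr; apply: eq_bigr => w wv.
  by rewrite eq_sym wv /= mulr1n mulr1 mulrC.
apply: ler_sum => v _; apply: ler_sum => w _.
have [->|vw] := eqVneq v w; first by rewrite d_refl !mulr0.
rewrite mulr1; have := joint_ge0 X Y v w; rewrite le_eqVlt => /orP[/eqP<-|J0].
  by rewrite !mul0r.
rewrite ler_pM2l//; apply: dD; apply: (lt_le_trans J0).
  exact: joint_lel.
exact: joint_ler.
Qed.

Lemma mean_dist_le_max D (X Y : R -> V) : 0 <= D ->
  fib_measurable X -> fib_measurable Y ->
  (forall v w, 0 < marg X v -> 0 < marg Y w -> d v w <= D) ->
  mean_dist X Y <= D.
Proof.
move=> D0 mX mY dD; apply: (le_trans (mean_dist_le D0 mX mY dD)).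
rewrite ler_piMr// lerBlDr lerDl; apply: sumr_ge0 => v _; exact: joint_ge0.
Qed.

Lemma mean_dist_mix (Y Y' : R -> Z) (W W' : Z -> R -> V) :
  fib_measurable Y -> (forall z, fib_measurable (W z)) ->
  fib_measurable Y' -> (forall z, fib_measurable (W' z)) ->
  mean_dist (mix Y W) (mix Y' W') =
  \sum_z \sum_z' joint Y Y' z z' * mean_dist (W z) (W' z').
Proof.
move=> mY mW mY' mW'; rewrite /mean_dist.
under eq_bigr => v _ do under eq_bigr => w _ do rewrite joint_mix// mulr_suml.
under eq_bigr => v _ do rewrite exchange_big/=.
rewrite exchange_big/=; apply: eq_bigr => z _.
under eq_bigr => v _ do under eq_bigr => w _ do rewrite mulr_suml.
under eq_bigr => v _ do rewrite exchange_big/=.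
rewrite exchange_big/=; apply: eq_bigr => z' _.
rewrite mulr_sumr; apply: eq_bigr => v _; rewrite mulr_sumr; apply: eq_bigr => w _.
by rewrite mulrA.
Qed.

(** Induction on the levels. Correlated sampling draws a vertex for each law, then the sampler of
    the remaining levels is run on the posterior. Different vertices cost at most [D]; a common
    vertex forces the posteriors within the next scale. *)
Lemma tree_sampler_exists eps l : 0 < eps -> channels l ->
  exists X : (V -> R) -> R -> V, is_sampler X /\
  forall D P Q, 0 <= D -> (forall v, 0 <= P v) -> (forall v, 0 <= Q v) ->
    0 < mass P -> 0 < mass Q -> supports_close D P Q ->
    Num.min (mass P) (mass Q) * mean_dist (X (normalize P)) (X (normalize Q)) <=
    (1 + eps) * tree_cost l D P Q.
Proof.
move=> e0; elim: l => [_|[D' f] l IH /= [[D'0 f0 f1 fD'] cl]].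
  have [G [sG hG]] := correlated_sampling v0 e0.
  exists G; split=> // D P Q D0 P0 Q0 tP tQ PQD /=.
  have nP := normalize_prob P0; have nQ := normalize_prob Q0.
  have [mP lP] := sG _ nP; have [mQ lQ] := sG _ nQ.
  have m0 : 0 <= Num.min (mass P) (mass Q) by rewrite le_min !ltW.
  apply: (@le_trans _ _ (Num.min (mass P) (mass Q) *
      (D * ((1 + eps) * dist1 (normalize P) (normalize Q))))).
    rewrite ler_wpM2l//; apply: (le_trans (mean_dist_le D0 mP mQ _)).
      move=> v w; rewrite lP lQ => /(normalize_gt0 P0 tP) ? /(normalize_gt0 Q0 tQ) ?.
      exact: PQD.
    by rewrite ler_wpM2l//; exact: hG.
  rewrite mulrCA [leRHS]mulrCA ler_wpM2l// mulrCA ler_wpM2l//; first by lra.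
  by rewrite /normalize !gt_eqF//; exact: dist1_normalized.
have [Xl [sXl hXl]] := IH cl.
have [G [sG hG]] := correlated_sampling z0 e0.
pose W P z := Xl (normalize (slice f z P)).
pose X P := mix (G (push f P)) (W P).
have slice0 P z : (forall v, 0 <= P v) -> forall v, 0 <= slice f z P v.
  by move=> P0 v; rewrite /slice mulr_ge0.
have mW P : (forall v, 0 <= P v) -> forall z, fib_measurable (W P z).
  by move=> P0 z; apply: (sXl _ _).1; apply: normalize_prob; exact: slice0.
have margW P z v : (forall v, 0 <= P v) -> marg (W P z) v = normalize (slice f z P) v.
  by move=> P0; apply: (sXl _ _).2; apply: normalize_prob; exact: slice0.
have mG P : is_prob P -> fib_measurable (G (push f P)).
  by move=> PP; apply: (sG _ _).1; exact: push_prob.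
have margG P z : is_prob P -> marg (G (push f P)) z = push f P z.
  by move=> PP; apply: (sG _ _).2; exact: push_prob.
exists X; split.
  move=> P PP; have [P0 P1] := PP.
  split; first exact: fib_measurable_mix (mG _ PP) (mW _ P0).
  move=> v; rewrite (marg_mix _ (mG _ PP) (mW _ P0)).
  rewrite -[RHS]mulr1 -(f1 v) mulr_sumr; apply: eq_bigr => z _.
  (* At a vertex of probability 0 the posterior is the junk point mass, but both sides vanish. *)
  rewrite margG// margW// /normalize mass_slice; case: eqP => [p0|/eqP p0].
    rewrite p0 mul0r; move/eqP: p0; rewrite psumr_eq0 => [/allP/(_ v)|w _].
      by rewrite mem_index_enum => /(_ isT)/eqP.
    by rewrite mulr_ge0.
  by rewrite /slice mulrCA divff// mulr1.
move=> D P Q D0 P0 Q0 tP tQ PQD.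
have nP := normalize_prob P0; have nQ := normalize_prob Q0.
set P' := normalize P in nP *; set Q' := normalize Q in nQ *.
have P'0 := nP.1; have Q'0 := nQ.1.
have P'E v : P' v = P v / mass P by rewrite /P' /normalize gt_eqF.
have Q'E v : Q' v = Q v / mass Q by rewrite /Q' /normalize gt_eqF.
have nsP z : normalize (slice f z P') = normalize (slice f z P).
  rewrite -[RHS](normalize_scale _ tP); congr normalize.
  by apply/funext => v; rewrite /slice P'E mulrAC.
have nsQ z : normalize (slice f z Q') = normalize (slice f z Q).
  rewrite -[RHS](normalize_scale _ tQ); congr normalize.
  by apply/funext => v; rewrite /slice Q'E mulrAC.
have pP z : push f P' z = push f P z / mass P.
  by rewrite /push mulr_suml; apply: eq_bigr => v _; rewrite P'E mulrAC.
have pQ z : push f Q' z = push f Q z / mass Q.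
  by rewrite /push mulr_suml; apply: eq_bigr => v _; rewrite Q'E mulrAC.
set m := Num.min (mass P) (mass Q).
have m0 : 0 <= m by rewrite le_min !ltW.
pose J := joint (G (push f P')) (G (push f Q')).
have J0 z z' : 0 <= J z z' by exact: joint_ge0.
have JP z z' : J z z' <= push f P' z.
  by rewrite -margG//; apply: joint_lel; exact: mG.
have JQ z z' : J z z' <= push f Q' z'.
  by rewrite -margG//; apply: joint_ler; exact: mG.
have nslice (p : V -> R) z v : (forall v, 0 <= p v) -> 0 < push f p z ->
    0 < normalize (slice f z p) v -> 0 < p v.
  move=> p0 pz /(normalize_gt0 (slice0 _ z p0) pz); rewrite /slice.
  by have := p0 v; rewrite le_eqVlt => /orP[/eqP <-|//]; rewrite mul0r ltxx.
have offdiag z z' : J z z' * mean_dist (W P' z) (W Q' z') <= J z z' * D.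
  have := J0 z z'; rewrite le_eqVlt => /orP[/eqP <-|Jp]; first by rewrite !mul0r.
  rewrite ler_pM2l//; apply: mean_dist_le_max; [exact: D0|exact: mW|exact: mW|].
  move=> v w; rewrite !margW//.
  move=> /(nslice _ _ _ P'0 (lt_le_trans Jp (JP _ _))) Pv.
  move=> /(nslice _ _ _ Q'0 (lt_le_trans Jp (JQ _ _))) Qw.
  by apply: PQD; [apply: (@normalize_gt0 P v P0 tP)|apply: (@normalize_gt0 Q w Q0 tQ)].
have diag z : m * (J z z * mean_dist (W P' z) (W Q' z)) <=
    (1 + eps) * tree_cost l D' (slice f z P) (slice f z Q).
  have e1 : 0 <= 1 + eps by lra.
  (* The right-hand side is the smaller mass of the two slices, the factor present in the induction
     hypothesis. *)
  have mJ : m * J z z <= Num.min (push f P z) (push f Q z).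
    rewrite le_min; apply/andP; split.
      apply: (@le_trans _ _ (mass P * (push f P z / mass P))).
        by rewrite -pP ler_pM// ge_min lexx.
      by rewrite mulrCA divff ?gt_eqF// mulr1.
    apply: (@le_trans _ _ (mass Q * (push f Q z / mass Q))).
      by rewrite -pQ ler_pM// ge_min lexx orbT.
    by rewrite mulrCA divff ?gt_eqF// mulr1.
  have md0 : 0 <= mean_dist (W P' z) (W Q' z).
    by apply: sumr_ge0 => v _; apply: sumr_ge0 => w _; rewrite mulr_ge0// joint_ge0.
  rewrite mulrA; have [pz|pz] := leP (Num.min (push f P z) (push f Q z)) 0.
    apply: (@le_trans _ _ 0); first by rewrite mulr_le0_ge0// (le_trans mJ).
    by rewrite mulr_ge0// tree_cost_ge0.
  move: pz; rewrite lt_min => /andP[pPz pQz].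
  apply: (@le_trans _ _ (Num.min (push f P z) (push f Q z) * mean_dist (W P' z) (W Q' z))).
    by rewrite ler_wpM2r.
  rewrite /W nsP nsQ; apply: hXl => //; try exact: slice0.
  move=> x y; rewrite /slice => Px Qy; apply: (fD' x y z).
    by move: Px; have := f0 x z; rewrite le_eqVlt => /orP[/eqP <-|//]; rewrite mulr0 ltxx.
  by move: Qy; have := f0 y z; rewrite le_eqVlt => /orP[/eqP <-|//]; rewrite mulr0 ltxx.
rewrite /X mean_dist_mix; [|exact: mG|exact: mW|exact: mG|exact: mW].
apply: (@le_trans _ _ (m * (D * (1 - agree (G (push f P')) (G (push f Q'))) +
   \sum_z J z z * mean_dist (W P' z) (W Q' z)))).
  rewrite ler_wpM2l//.
  have -> : D * (1 - agree (G (push f P')) (G (push f Q'))) =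
      \sum_z \sum_(z' | z' != z) J z z' * D.
    rewrite -[X in D * (X - _)](sum_marg (mG _ nP)) /agree -sumrB mulr_sumr; apply: eq_bigr => z _.
    rewrite -(sum_joint z (mG _ nP) (mG _ nQ)) (bigD1 z)//= addrAC subrr add0r.
    by rewrite -mulr_suml mulrC.
  rewrite -big_split/=; apply: ler_sum => z _; rewrite (bigD1 z)//= addrC lerD2r.
  by apply: ler_sum => z' _; exact: offdiag.
rewrite [leLHS]mulrDr [leRHS]mulrDr; apply: lerD; last first.
  by rewrite !mulr_sumr; apply: ler_sum => z _; exact: diag.
rewrite mulrCA [leRHS]mulrCA ler_wpM2l//.
apply: (@le_trans _ _ (m * ((1 + eps) * dist1 (push f P') (push f Q')))).
  by rewrite ler_wpM2l//; apply: hG; exact: push_prob.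
rewrite mulrCA ler_wpM2l//; first by lra.
have -> : push f P' = fun z => push f P z / mass P by apply/funext.
have -> : push f Q' = fun z => push f Q z / mass Q by apply/funext.
by apply: dist1_normalized; rewrite ?sum_push// => z; exact: push_ge0.
Qed.

End tree.

(** * Reduction to point masses, and their cost through the Hellinger affinity *)

Section point_cost.
Context {R : realType} (V Z : finType).
Implicit Types (P Q : V -> R) (f : V -> Z -> R) (D : R) (l : seq (R * (V -> Z -> R))).

(* [tree_cost] of the weights [a delta_x] and [b delta_y]. *)
Fixpoint point_cost l D x y (a b : R) : R :=
  if l is (D', f) :: l' then
    D * (\sum_z `|a * f x z - b * f y z| + `|a - b|) +
    \sum_z point_cost l' D' x y (a * f x z) (b * f y z)
  else D * ((if x == y then `|a - b| else a + b) + `|a - b|).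

Lemma point_cost_diag l D x a : point_cost l D x x a a = 0.
Proof.
elim: l D a => [|[D' f] l IH] D a /=.
  by rewrite eqxx subrr normr0 addr0 mulr0.
by rewrite !big1 => [|z _|z _]; rewrite ?IH ?subrr ?normr0 ?addr0 ?mulr0.
Qed.

Lemma dist_le_coupling (W : finType) (p q : W -> R) (pi : V -> V -> R) (s t : V -> W -> R) :
  (forall x y, 0 <= pi x y) ->
  (forall w, p w = \sum_x \sum_y pi x y * s x w) ->
  (forall w, q w = \sum_x \sum_y pi x y * t y w) ->
  dist1 p q <= \sum_x \sum_y pi x y * \sum_w `|s x w - t y w|.
Proof.
move=> pi0 pE qE.
apply: (@le_trans _ _ (\sum_w \sum_x \sum_y pi x y * `|s x w - t y w|)).
  apply: ler_sum => w _; rewrite pE qE -sumrB.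
  apply: (le_trans (ler_norm_sum _ _ _)); apply: ler_sum => x _; rewrite -sumrB.
  apply: (le_trans (ler_norm_sum _ _ _)); apply: ler_sum => y _.
  by rewrite -mulrBr normrM ger0_norm.
rewrite exchange_big/=; apply: ler_sum => x _; rewrite exchange_big/=.
by apply: ler_sum => y _; rewrite mulr_sumr.
Qed.

Lemma mass_dist_le (p q : V -> R) (pi : V -> V -> R) (al be : V -> R) :
  (forall x y, 0 <= pi x y) ->
  (forall x, p x = \sum_y pi x y * al x) -> (forall y, q y = \sum_x pi x y * be y) ->
  `|mass p - mass q| <= \sum_x \sum_y pi x y * `|al x - be y|.
Proof.
move=> pi0 pE qE.
have -> : mass p = \sum_x \sum_y pi x y * al x by apply: eq_bigr => x _.
have -> : mass q = \sum_x \sum_y pi x y * be y.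
  by rewrite exchange_big/=; apply: eq_bigr => x _.
rewrite -sumrB; apply: (le_trans (ler_norm_sum _ _ _)); apply: ler_sum => x _.
rewrite -sumrB; apply: (le_trans (ler_norm_sum _ _ _)); apply: ler_sum => y _.
by rewrite -mulrBr normrM ger0_norm.
Qed.

(** Convexity of the norms in [tree_cost]: [pi] writes [P] and [Q] as mixtures, with common
    coefficients, of point weights [al x] at [x] and [be y] at [y]. Slicing keeps [pi] and only
    multiplies [al] and [be] by the channel weights, so the induction closes. *)
Lemma tree_cost_le_point d l D P Q (pi : V -> V -> R) (al be : V -> R) :
  channels d l -> 0 <= D -> (forall x y, 0 <= pi x y) ->
  (forall v, 0 <= al v) -> (forall v, 0 <= be v) ->
  (forall x, P x = \sum_y pi x y * al x) -> (forall y, Q y = \sum_x pi x y * be y) ->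
  tree_cost l D P Q <= \sum_x \sum_y pi x y * point_cost l D x y (al x) (be y).
Proof.
move=> + + pi0.
elim: l D P Q al be => [|[D' f] l IH] D P Q al be /=.
  move=> _ D0 al0 be0 PE QE.
  have dPQ : dist1 P Q <= \sum_x \sum_y pi x y *
      (if x == y then `|al x - be y| else al x + be y).
    apply: le_trans (@dist_le_coupling V P Q pi
      (fun x w => al x * (x == w)%:R) (fun y w => be y * (y == w)%:R) pi0 _ _) _.
    - move=> w; rewrite PE [RHS](bigD1 w)//= [X in _ + X]big1 ?addr0 => [|x /negPf xw].
        by apply: eq_bigr => y _; rewrite eqxx mulr1.
      by apply: big1 => y _; rewrite xw !mulr0.
    - move=> w; rewrite QE exchange_big/= [RHS](bigD1 w)//= [X in _ + X]big1 ?addr0 => [|y /negPf yw].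
        by apply: eq_bigr => x _; rewrite eqxx mulr1.
      by apply: big1 => x _; rewrite yw !mulr0.
    apply: ler_sum => x _; apply: ler_sum => y _; rewrite ler_wpM2l//.
    have [<-|xy] := eqVneq x y.
      rewrite (bigD1 x)//= eqxx !mulr1 big1 ?addr0// => w /negPf wx.
      by rewrite eq_sym wx !mulr0 subrr normr0.
    have yx : y != x by rewrite eq_sym.
    rewrite (bigD1 x)//= (bigD1 y)//= !eqxx (negPf xy) (negPf yx).
    rewrite !mulr0 !mulr1 subr0 sub0r normrN !ger0_norm// big1 ?addr0// => w /andP[wx wy].
    by rewrite ![_ == w]eq_sym (negPf wx) (negPf wy) !mulr0 subrr normr0.
  have tPQ := mass_dist_le pi0 PE QE.
  apply: (@le_trans _ _ (D * \sum_x \sum_y pi x y *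
     ((if x == y then `|al x - be y| else al x + be y) + `|al x - be y|))).
    rewrite ler_wpM2l//; under eq_bigr do under eq_bigr do rewrite mulrDr.
    by under eq_bigr do rewrite big_split/=; rewrite big_split/=; exact: lerD.
  rewrite mulr_sumr; apply: ler_sum => x _; rewrite mulr_sumr; apply: ler_sum => y _.
  by rewrite mulrCA.
move=> [[D'0 f0 f1 _] cl] D0 al0 be0 PE QE.
have pushPE z : push f P z = \sum_x \sum_y pi x y * (al x * f x z).
  apply: eq_bigr => x _; rewrite PE mulr_suml.
  by apply: eq_bigr => y _; rewrite mulrA.
have pushQE z : push f Q z = \sum_x \sum_y pi x y * (be y * f y z).
  rewrite exchange_big; apply: eq_bigr => y _; rewrite QE mulr_suml.
  by apply: eq_bigr => x _; rewrite mulrA.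
have dPQ := dist_le_coupling pi0 pushPE pushQE.
have tPQ := mass_dist_le pi0 PE QE.
have splitE (s t : V -> V -> R) : \sum_x \sum_y pi x y * (s x y + t x y) =
    \sum_x \sum_y pi x y * s x y + \sum_x \sum_y pi x y * t x y.
  rewrite -big_split/=; apply: eq_bigr => x _; rewrite -big_split/=.
  by apply: eq_bigr => y _; rewrite mulrDr.
rewrite splitE; apply: lerD.
  apply: (@le_trans _ _ (D * \sum_x \sum_y pi x y *
     (\sum_z `|al x * f x z - be y * f y z| + `|al x - be y|))).
    by rewrite ler_wpM2l// splitE; exact: lerD.
  rewrite mulr_sumr; apply: ler_sum => x _; rewrite mulr_sumr; apply: ler_sum => y _.
  by rewrite mulrCA.
apply: (@le_trans _ _ (\sum_z \sum_x \sum_y pi x y *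
    point_cost l D' x y (al x * f x z) (be y * f y z))).
  apply: ler_sum => z _.
  apply: (IH D' _ _ (fun x => al x * f x z) (fun y => be y * f y z)) => //.
  - by move=> v; rewrite mulr_ge0.
  - by move=> v; rewrite mulr_ge0.
  - by move=> x; rewrite /slice PE mulr_suml; apply: eq_bigr => y _; rewrite mulrA.
  - by move=> y; rewrite /slice QE mulr_suml; apply: eq_bigr => x _; rewrite mulrA.
rewrite exchange_big/=; apply: ler_sum => x _; rewrite exchange_big/=.
by apply: ler_sum => y _; rewrite mulr_sumr.
Qed.

Definition affinity f x y : R := \sum_z Num.sqrt (f x z * f y z).

Fixpoint quarter_scales (e : R) x y l D : Prop :=
  if l is (D', f) :: l' then
    [/\ D = 4 * D', 1 - affinity f x y <= e / D' ^+ 2 & quarter_scales e x y l' D']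
  else True.

(* The last term is a potential: [a + b - 2 * sqrt (a * b)] is the square of
   [sqrt a - sqrt b]; its sum over the outputs of a channel grows by at most
   [(1 - affinity) * (a + b)], while [D ^ 2] is divided by 16. *)
Lemma point_cost_quarter_scales d l D x y e c a b :
  channels d l -> quarter_scales e x y l D -> x != y -> 0 < D -> 0 <= e -> 0 < c ->
  0 <= a -> 0 <= b ->
  point_cost l D x y a b <= D * `|a - b| + D / 4 ^+ size l * (a + b) +
    (size l)%:R * (5 * c + 8 / 3 * e / c) * (a + b) +
    D ^+ 2 / (6 * c) * (a + b - 2 * Num.sqrt (a * b)).
Proof.
move=> + + xy D0 e0 c0.
have amgm (p q : R) : 0 <= p -> 0 <= q -> 0 <= p + q - 2 * Num.sqrt (p * q).
  move=> p0 q0; rewrite sqrtrM// -{1}(sqr_sqrtr p0) -{1}(sqr_sqrtr q0).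
  have := sqr_ge0 (Num.sqrt p - Num.sqrt q); nra.
elim: l D D0 a b => [|[D' f] l IH] D D0 a b /=.
  move=> _ _ a0 b0; rewrite (negPf xy) expr0 divr1 !mul0r addr0.
  have : 0 <= D ^+ 2 / (6 * c) * (a + b - 2 * Num.sqrt (a * b)).
    by rewrite mulr_ge0 ?amgm// divr_ge0 ?sqr_ge0// mulr_ge0 ?ltW.
  by rewrite mulrDr addrC; set u := _ / _ * _; lra.
move=> [[D'0 f0 f1 _] cl] [DE aff geo] a0 b0.
have D'p : 0 < D' by move: D0; rewrite DE; lra.
pose az z := a * f x z; pose bz z := b * f y z.
have az0 z : 0 <= az z by rewrite mulr_ge0.
have bz0 z : 0 <= bz z by rewrite mulr_ge0.
pose u z := az z + bz z - 2 * Num.sqrt (az z * bz z).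
pose S := \sum_z `|az z - bz z|.
pose U := \sum_z u z.
have sumab : \sum_z (az z + bz z) = a + b.
  by rewrite big_split/= -!mulr_sumr !f1 !mulr1.
have UE : U = a + b - 2 * Num.sqrt (a * b) * affinity f x y.
  rewrite /U sumrB sumab; congr (_ - _); rewrite /affinity mulr_sumr.
  apply: eq_bigr => z _; rewrite -mulrA; congr (2 * _).
  by rewrite -sqrtrM ?mulr_ge0//; congr Num.sqrt; rewrite /az /bz; ring.
have U_le : U <= (a + b - 2 * Num.sqrt (a * b)) + (a + b) * (e / D' ^+ 2).
  have s0 := sqrtr_ge0 (a * b); have := amgm _ _ a0 b0 => ab.
  have e1 : 0 <= e / D' ^+ 2 by rewrite divr_ge0 ?sqr_ge0.
  rewrite UE; move: aff s0 ab e1; set r := affinity _ _ _; set t := e / _.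
  set s := Num.sqrt _ => aff s0 ab e1.
  have : 2 * s * (1 - r) <= 2 * s * t by rewrite ler_wpM2l// mulr_ge0.
  have : 2 * s * t <= (a + b) * t by rewrite ler_wpM2r//; lra.
  lra.
(* Weight of the AM-GM inequality below, scaled so that a level contributes [5 * D' * k = 5 * c],
   whatever its scale. *)
pose k := c / D'.
have k0 : 0 < k by rewrite divr_gt0.
have S_le : S <= k * (a + b) + U / (2 * k).
  rewrite /S /U -sumab mulr_sumr mulr_suml -big_split/=; apply: ler_sum => z _.
  have sa := sqrtr_ge0 (az z); have sb := sqrtr_ge0 (bz z).
  rewrite /u sqrtrM//.
  rewrite -{1 2 3}(sqr_sqrtr (az0 z)) -{1 2 3}(sqr_sqrtr (bz0 z)).
  move: sa sb; set p := Num.sqrt _; set q := Num.sqrt _ => p0 q0.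
  have -> : p ^+ 2 - q ^+ 2 = (p - q) * (p + q) by ring.
  have -> : p ^+ 2 + q ^+ 2 - 2 * (p * q) = (p - q) ^+ 2 by ring.
  have sq : (p + q) ^+ 2 <= 2 * (p ^+ 2 + q ^+ 2) by have := sqr_ge0 (p - q); nra.
  have key : `|(p - q) * (p + q)| <= k / 2 * (p + q) ^+ 2 + (p - q) ^+ 2 / (2 * k).
    rewrite -subr_ge0 normrM -(real_normK (num_real (p - q))) (ger0_norm (addr_ge0 p0 q0)).
    set v := `|p - q|; set w := p + q.
    have -> : k / 2 * w ^+ 2 + v ^+ 2 / (2 * k) - v * w = (k * w - v) ^+ 2 / (2 * k).
      by field; rewrite gt_eqF.
    by rewrite divr_ge0 ?sqr_ge0// mulr_ge0// ltW.
  apply: (le_trans key); rewrite lerD2r.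
  have := ler_wpM2l (ltW k0) sq; lra.
have IHs : \sum_z point_cost l D' x y (az z) (bz z) <=
    D' * S + D' / 4 ^+ size l * (a + b) +
    (size l)%:R * (5 * c + 8 / 3 * e / c) * (a + b) + D' ^+ 2 / (6 * c) * U.
  rewrite /S /U -sumab !mulr_sumr -!big_split/=; apply: ler_sum => z _.
  exact: IH.
apply: (le_trans (lerD (lexx _) IHs)).
rewrite -/az -/bz -/S.
rewrite DE [4 ^+ _.+1]exprS.
have -> : 4 * D' / (4 * 4 ^+ size l) = D' / 4 ^+ size l.
  by field; rewrite expf_neq0.
rewrite -[(size l).+1%:R]natr1.
move: S_le U_le; set A := D' / _ * _; set kap := 5 * c + _; set n := (size l)%:R.
set u0 := a + b - 2 * _ => S_le U_le.
(* Here [5 = 4 + 1]: [D = 4 * D'] at this level, and [D'] from the first term of the induction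
   hypothesis. *)
have h1 : 5 * D' * S <= 5 * c * (a + b) + 5 * D' ^+ 2 / (2 * c) * U.
  have := ler_wpM2l (mulr_ge0 (ler0n R 5) D'0) S_le.
  have -> : 5 * D' * (k * (a + b) + U / (2 * k)) =
     5 * c * (a + b) + 5 * D' ^+ 2 / (2 * c) * U.
    by rewrite /k; field; rewrite !gt_eqF.
  by [].
have h2 : (8 / 3) * D' ^+ 2 / c * U <=
    (8 / 3) * D' ^+ 2 / c * u0 + 8 / 3 * e / c * (a + b).
  have g0 : 0 <= 8 / 3 * D' ^+ 2 / c by rewrite !mulr_ge0 ?sqr_ge0 ?invr_ge0 ?ltW.
  have := ler_wpM2l g0 U_le; rewrite mulrDr.
  have -> : 8 / 3 * D' ^+ 2 / c * ((a + b) * (e / D' ^+ 2)) = 8 / 3 * e / c * (a + b).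
    by field; rewrite !gt_eqF.
  by [].
have -> : (4 * D') ^+ 2 / (6 * c) * u0 = 8 / 3 * D' ^+ 2 / c * u0.
  by field; rewrite gt_eqF.
(* The coefficient [1 / 6] of the potential solves [5 / 2 + u = 16 * u], the factor 16 coming from
   [D ^ 2 = 16 * D' ^ 2]. *)
have e3 : 5 * D' ^+ 2 / (2 * c) * U + D' ^+ 2 / (6 * c) * U = 8 / 3 * D' ^+ 2 / c * U.
  by field; rewrite gt_eqF.
rewrite /kap; move: h1 h2 e3.
set X1 := 5 * D' ^+ 2 / _ * U; set X2 := D' ^+ 2 / _ * U; set X3 := 8 / 3 * D' ^+ 2 / c * U.
set X4 := 8 / 3 * D' ^+ 2 / c * u0; set X5 := 8 / 3 * e / c => h1 h2 e3.
set w := `|a - b|.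
have -> : (n + 1) * (5 * c + X5) * (a + b) =
  n * (5 * c + X5) * (a + b) + 5 * c * (a + b) + X5 * (a + b) by ring.
set X6 := n * _ * _; nra.
Qed.

End point_cost.

(** * Grid channels *)

Section trig_bounds.
Context {R : realType}.

Lemma sin_mvt (s : R) : 0 < s -> exists2 c, 0 < c < s & sin s = cos c * s.
Proof.
move=> s0.
have [|c] := @MVT R sin cos 0 s s0.
  by apply: continuous_subspaceT => x; exact: continuous_sin.
by rewrite in_itv/= sin0 !subr0 => c0s cE; exists c.
Qed.

Lemma sqr_sin_le (s : R) : sin s ^+ 2 <= s ^+ 2.
Proof.
have pos (t : R) : 0 < t -> sin t ^+ 2 <= t ^+ 2.
  move=> t0; have [c _ ->] := sin_mvt t0.
  rewrite exprMn; apply: ler_piMl; first exact: sqr_ge0.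
  have := cos2Dsin2 c; have := sqr_ge0 (sin c); lra.
have [s0|s0|->] := ltgtP s 0; last by rewrite sin0.
  by rewrite -(sqrrN s) -(sqrrN (sin s)) -sinN; apply: pos; rewrite oppr_gt0.
exact: pos.
Qed.

Lemma cos_ge_quadratic (t : R) : 1 - t ^+ 2 / 2 <= cos t.
Proof.
have -> : cos t = 2 * cos (t / 2) ^+ 2 - 1.
  have {1}-> : t = (t / 2) *+ 2 by rewrite -mulr_natr; field.
  by rewrite cos_mulr2n mulr_natl.
have := sqr_sin_le (t / 2); have := cos2Dsin2 (t / 2); nra.
Qed.

(** Otherwise [cos (7 / 4)] would be positive, whereas doubling the angle twice from [7 / 16] bounds
    it by [2 * (7 / 10) ^ 2 - 1 < 0]. *)
Lemma pihalf_le : pi / 2 <= 7 / 4 :> R.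
Proof.
rewrite leNgt; apply/negP => h.
have c0 : 0 < cos (7 / 4 : R) by apply: cos_gt0_pihalf; lra.
have s0 : 0 < 7 / 16 :> R by lra.
have [c c01 sE] := sin_mvt s0.
have cc := cos_ge_quadratic c.
have s1 : 39 / 100 <= sin (7 / 16) :> R by rewrite sE; nra.
have cE : cos (7 / 8 : R) = 1 - 2 * sin (7 / 16) ^+ 2.
  have -> : 7 / 8 = (7 / 16) *+ 2 :> R by rewrite -mulr_natr; field.
  by rewrite cos_mulr2n mulr2n; have := cos2Dsin2 (7 / 16 : R); lra.
have c1 : 0 <= cos (7 / 8 : R) by apply: ltW; apply: cos_gt0_pihalf; lra.
have c2 : cos (7 / 8 : R) <= 7 / 10 by rewrite cE; nra.
have cE2 : cos (7 / 4 : R) = 2 * cos (7 / 8) ^+ 2 - 1.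
  have -> : 7 / 4 = (7 / 8) *+ 2 :> R by rewrite -mulr_natr; field.
  by rewrite cos_mulr2n mulr2n; ring.
nra.
Qed.

End trig_bounds.

(** * Cosine bumps at the integers *)

Section hump.
Context {R : realType}.

Definition hump (u : R) : R := if `|u| < 1 then cos (pi / 2 * u) else 0.

Lemma hump_ge0 u : 0 <= hump u.
Proof.
rewrite /hump; case: ifP => // /[!ltr_norml] u1; apply: cos_ge0_pihalf.
have := @pihalf_ge1 R; nra.
Qed.

Lemma hump_left u : 0 <= u < 1 -> hump u = cos (pi / 2 * u).
Proof. by move=> u01; rewrite /hump ger0_norm ?ifT; lra. Qed.

Lemma hump_right u : 0 <= u < 1 -> hump (u - 1) = sin (pi / 2 * u).
Proof.
move=> u01; rewrite /hump ler0_norm; last by lra.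
case: ifPn => [_|]; first by rewrite mulrBr mulr1 cosBpihalf.
rewrite -leNgt => h; have -> : u = 0 by lra.
by rewrite mulr0 sin0.
Qed.

Lemma hump_gt0 u : 0 < hump u -> `|u| < 1.
Proof. by rewrite /hump; case: ifP => //; rewrite ltxx. Qed.

Lemma truncn_frac (x : R) : 0 <= x -> 0 <= x - (Num.truncn x)%:R < 1.
Proof. by move=> x0; have := truncn_itv x0; rewrite -natr1; lra. Qed.

Variable M : nat.
Implicit Type z : 'I_M.+2.

(** Square root of the probability of the vertex [z], so that affinities become inner products. For
    [x] in [[0, M]] the upper neighbour can be [M.+1], hence [M.+2] vertices. *)
Definition cell (x : R) z : R := hump (x - z%:R).

Lemma cell_ge0 x z : 0 <= cell x z. Proof. exact: hump_ge0. Qed.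

Definition floor_ord (x : R) : 'I_M.+2 := inord (Num.truncn x).
Definition ceil_ord (x : R) : 'I_M.+2 := inord (Num.truncn x).+1.

Section in_range.
Variable x : R.
Hypothesis xM : 0 <= x <= M%:R.

Lemma truncn_le : (Num.truncn x <= M)%N.
Proof.
have /andP[x0 x1] := xM; rewrite -(ler_nat R); apply: le_trans x1.
by have /andP[] := truncn_itv x0.
Qed.

Lemma floor_ordE : floor_ord x = Num.truncn x :> nat.
Proof. by rewrite inordK// ltnS; apply: leq_trans truncn_le _. Qed.

Lemma ceil_ordE : ceil_ord x = (Num.truncn x).+1 :> nat.
Proof. by rewrite inordK// !ltnS truncn_le. Qed.

Let frac_bound : 0 <= x - (Num.truncn x)%:R < 1.
Proof. by apply: truncn_frac; case/andP: xM. Qed.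

Lemma cell_floor : cell x (floor_ord x) = cos (pi / 2 * (x - (Num.truncn x)%:R)).
Proof. by rewrite /cell floor_ordE hump_left. Qed.

Lemma cell_ceil : cell x (ceil_ord x) = sin (pi / 2 * (x - (Num.truncn x)%:R)).
Proof. by rewrite /cell ceil_ordE -natr1 opprD addrA hump_right. Qed.

Lemma cell_eq0 z : z != floor_ord x -> z != ceil_ord x -> cell x z = 0.
Proof.
rewrite -!(inj_eq val_inj)/= floor_ordE ceil_ordE => zf zc.
rewrite /cell /hump ifF//; apply/negP => /[!ltr_norml] zx.
have fb := frac_bound.
have z1 : z%:R < (Num.truncn x).+2%:R :> R.
  by rewrite -natr1 -natr1; lra.
have z2 : (Num.truncn x)%:R < z%:R + 1 :> R by lra.
rewrite ltr_nat ltnS in z1; rewrite natr1 ltr_nat ltnS in z2.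
move: z1; rewrite leq_eqVlt (negPf zc)/= ltnS => z1.
by move: zf; rewrite eqn_leq z1 z2.
Qed.

Lemma floor_neq_ceil : ceil_ord x != floor_ord x.
Proof.
by rewrite -(inj_eq val_inj)/= floor_ordE ceil_ordE gtn_eqF.
Qed.

Lemma sum_cell_sq : \sum_z cell x z ^+ 2 = 1.
Proof.
rewrite (bigD1 (floor_ord x))//= (bigD1 (ceil_ord x)) ?floor_neq_ceil//=.
rewrite big1 ?addr0 => [|z /andP[zf zc]]; last by rewrite cell_eq0// expr0n.
by rewrite cell_floor cell_ceil cos2Dsin2.
Qed.

End in_range.

Lemma cell_inner_ge0 x y : 0 <= \sum_z cell x z * cell y z.
Proof. by apply: sumr_ge0 => z _; rewrite mulr_ge0 ?cell_ge0. Qed.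

Lemma cell_inner_le1 x y : 0 <= x <= M%:R -> 0 <= y <= M%:R ->
  \sum_z cell x z * cell y z <= 1.
Proof.
move=> xM yM.
have -> : 1 = \sum_z (cell x z ^+ 2 + cell y z ^+ 2) / 2 :> R.
  by rewrite -mulr_suml big_split/= !sum_cell_sq//; field.
apply: ler_sum => z _; have := sqr_ge0 (cell x z - cell y z); nra.
Qed.

(** In a common cell the inner product is exactly [cos (pi / 2 * (x - y))]; in adjacent cells the
    shared vertex alone gives at least that. Otherwise [|x - y| > 1] and the left-hand side is
    negative. The constant is [49 / 32 = (7 / 4) ^ 2 / 2]. *)
Lemma cell_inner_ge x y : 0 <= x <= M%:R -> 0 <= y <= M%:R ->
  1 - 49 / 32 * (x - y) ^+ 2 <= \sum_z cell x z * cell y z.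
Proof.
wlog xy : x y / x <= y.
  move=> W xM yM; have [xy|/ltW yx] := leP x y; first exact: W.
  rewrite -(sqrrN (x - y)) opprB; under eq_bigr do rewrite mulrC.
  exact: W.
move=> xM yM.
have x0 : 0 <= x by case/andP: xM.
have y0 : 0 <= y by case/andP: yM.
have cosb (t u : R) : t = pi / 2 * u -> 1 - 49 / 32 * u ^+ 2 <= cos t.
  move=> ->; apply: le_trans (cos_ge_quadratic _).
  have := @pihalf_le R; have := @pihalf_ge1 R => p1 p2.
  rewrite exprMn; have : (pi / 2) ^+ 2 <= 49 / 16 :> R by nra.
  have := sqr_ge0 u; nra.
have sub1 z : cell x z * cell y z <= \sum_z cell x z * cell y z.
  by rewrite (bigD1 z)//= lerDl sumr_ge0// => w _; rewrite mulr_ge0 ?cell_ge0.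
have kl : (Num.truncn x <= Num.truncn y)%N by exact: le_truncn.
have fx := truncn_frac x0; have fy := truncn_frac y0.
have [e|ne] := eqVneq (Num.truncn x) (Num.truncn y).
  rewrite (bigD1 (floor_ord x))//= (bigD1 (ceil_ord x)) ?floor_neq_ceil//=.
  have fE : floor_ord x = floor_ord y by rewrite /floor_ord e.
  have cE : ceil_ord x = ceil_ord y by rewrite /ceil_ord e.
  rewrite addrA; apply: (@le_trans _ _ (cell x (floor_ord x) * cell y (floor_ord x) +
      cell x (ceil_ord x) * cell y (ceil_ord x))); last first.
    by rewrite lerDl sumr_ge0// => w _; rewrite mulr_ge0 ?cell_ge0.
  rewrite {2}fE {2}cE !cell_floor// !cell_ceil// -cosB; apply: cosb.
  by rewrite e; ring.
have [e|ne2] := eqVneq (Num.truncn x).+1 (Num.truncn y).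
  apply: le_trans (sub1 (ceil_ord x)).
  have cE : ceil_ord x = floor_ord y by rewrite /floor_ord -e.
  rewrite {2}cE cell_ceil// cell_floor//.
  set A := pi / 2 * (x - _); set B := pi / 2 * (y - _).
  have -> : sin A = cos (pi / 2 - A) by rewrite -[RHS]cosN opprB cosBpihalf.
  apply: (@le_trans _ _ (cos (pi / 2 - A + B))).
    rewrite -(sqrrN (x - y)) opprB; apply: cosb.
    by rewrite /A /B -e -[(Num.truncn x).+1%:R]natr1; ring.
  rewrite cosD lerBlDr lerDl mulr_ge0//; apply: sin_ge0_pi.
    by rewrite /A; have := @pihalf_ge1 R; nra.
  by rewrite /B; have := @pihalf_ge1 R; nra.
apply: le_trans (cell_inner_ge0 x y).
have k2 : ((Num.truncn x).+2 <= Num.truncn y)%N by rewrite ltn_neqAle ne2 ltn_neqAle ne.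
have : (Num.truncn x).+2%:R <= (Num.truncn y)%:R :> R by rewrite ler_nat.
by rewrite -[(Num.truncn x).+2%:R]natr1 -[(Num.truncn x).+1%:R]natr1 => ?; nra.
Qed.

End hump.

Section grid_channel.
Context {R : realType} (V : finType) (n M : nat) (x : V -> 'I_n -> R).
Hypothesis xM : forall v i, 0 <= x v i <= M%:R.

Definition grid := {ffun 'I_n -> 'I_M.+2}.

Definition grid_channel (v : V) (z : grid) : R := \prod_i cell (x v i) (z i) ^+ 2.

Lemma grid_channel_ge0 v z : 0 <= grid_channel v z.
Proof. by apply: prodr_ge0 => i _; rewrite sqr_ge0. Qed.

Lemma sum_grid_channel v : \sum_z grid_channel v z = 1.
Proof.
rewrite /grid_channel -(bigA_distr_bigA (fun i (j : 'I_M.+2) => cell (x v i) j ^+ 2)).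
by apply: big1 => i _; rewrite sum_cell_sq.
Qed.

Lemma grid_channel_close v w z i : 0 < grid_channel v z -> 0 < grid_channel w z ->
  `|x v i - x w i| < 2.
Proof.
have pos u : 0 < grid_channel u z -> `|x u i - (z i)%:R| < 1.
  rewrite /grid_channel (bigD1 i)//=.
  have := cell_ge0 (x u i) (z i); rewrite le_eqVlt => /orP[/eqP<-|/hump_gt0//].
  by rewrite expr0n/= mul0r ltxx.
by move=> /pos vz /pos wz; move: vz wz; rewrite !ltr_norml; lra.
Qed.

(** A union bound; the induction also carries that the product stays in [[0, 1]]. *)
Lemma prod_ge (r : 'I_n -> R) : (forall i, 0 <= r i <= 1) ->
  1 - \prod_i r i <= \sum_i (1 - r i).
Proof.
move=> r01.
suff : 0 <= \prod_i r i <= 1 /\ 1 - \prod_i r i <= \sum_i (1 - r i) by case.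
apply: (big_ind2 (fun p s => 0 <= p <= 1 /\ 1 - p <= s)).
- by rewrite subrr ler01 lexx.
- move=> p s p' s' [p01 h] [p'01 h']; split; last by nra.
  by have /andP[a b] := p01; have /andP[a' b'] := p'01; rewrite mulr_ge0 ?mulr_ile1.
- by move=> i _; split.
Qed.

(** The weights are products of squares, so the affinity is the product over the coordinates of the
    inner products of cells. *)
Lemma grid_channel_affinity v w :
  1 - affinity grid_channel v w <= 49 / 32 * \sum_i (x v i - x w i) ^+ 2.
Proof.
have -> : affinity grid_channel v w = \prod_i \sum_(j : 'I_M.+2) cell (x v i) j * cell (x w i) j.
  rewrite (bigA_distr_bigA (fun i (j : 'I_M.+2) => cell (x v i) j * cell (x w i) j)).
  apply: eq_bigr => z _; rewrite /grid_channel -big_split/=.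
  rewrite (eq_bigr (fun i => (cell (x v i) (z i) * cell (x w i) (z i)) ^+ 2)); last first.
    by move=> i _; rewrite exprMn.
  by rewrite prodrXl sqrtr_sqr ger0_norm// prodr_ge0// => i _; rewrite mulr_ge0 ?cell_ge0.
apply: (le_trans (prod_ge _)) => [i|].
  by rewrite cell_inner_ge0 cell_inner_le1.
rewrite mulr_sumr; apply: ler_sum => i _.
have := cell_inner_ge (xM v i) (xM w i); lra.
Qed.

End grid_channel.

(** * The grid channels at all scales *)

Section multiscale.
Context {R : realType} (V : finType) (v0 : V) (n : nat) (x : V -> 'I_n -> R).
Variables (d : V -> V -> R) (om m : R).
Hypotheses (d_ge0 : forall v w, 0 <= d v w) (d_refl : forall v, d v v = 0).
Hypotheses (d_gt0 : forall v w, v != w -> 0 < d v w) (om_gt0 : 0 < om) (m_gt0 : 0 < m).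
Hypothesis d_cube : forall v w (t : R), 0 <= t ->
  (forall i, `|x v i - x w i| <= t) -> d v w <= om * t.
Hypothesis d_euclid : forall v w,
  om ^+ 2 * \sum_i (x v i - x w i) ^+ 2 <= (m * d v w) ^+ 2.

(** All levels share one output type, hence one [M]; the assumption on it is what the finest scale
    [D / 4 ^ K] needs to cover [[- B, B]]. *)
Lemma multiscale_channels (B D : R) (K M : nat) : 0 < D ->
  (forall v i, - B <= x v i <= B) -> 4 * B * om * 4 ^+ K / D <= M%:R ->
  exists l : seq (R * (V -> grid n M -> R)),
    [/\ size l = K, channels d l &
        forall v w, quarter_scales (49 / 8 * (m * d v w) ^+ 2) v w l D].
Proof.
move=> + xB.
elim: K D => [|K IH] D D0 hM; first by exists [::].
pose D' := D / 4.
have D'0 : 0 < D' by rewrite divr_gt0.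
have hM' : 4 * B * om * 4 ^+ K / D' <= M%:R.
  have -> : 4 * B * om * 4 ^+ K / D' = 4 * B * om * 4 ^+ K.+1 / D.
    by rewrite /D' exprS; field; rewrite gt_eqF.
  exact: hM.
have [l [sl cl gl]] := IH D' D'0 hM'.
(* Points seeing a common vertex have coordinates within [2 * w], so [d_cube] puts them within
   [om * (2 * w) = D']. *)
pose w := D' / (2 * om).
have w0 : 0 < w by rewrite divr_gt0// mulr_gt0.
pose y v i := (x v i + B) / w.
have yM v i : 0 <= y v i <= M%:R.
  have xb := xB v i.
  have B0 : 0 <= B by lra.
  have y0 : 0 <= y v i by apply: divr_ge0; [lra | exact: ltW].
  rewrite y0/= /y ler_pdivrMr//; apply: (@le_trans _ _ (2 * B)); first by lra.
  apply: (@le_trans _ _ (4 * B * om * 4 ^+ K / D' * w)); last by rewrite ler_pM2r.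
  have -> : 4 * B * om * 4 ^+ K / D' * w = 2 * B * 4 ^+ K.
    by rewrite /w; field; rewrite !gt_eqF.
  by rewrite ler_peMr ?mulr_ge0// exprn_ege1// ler1n.
have yB v u i : y v i - y u i = (x v i - x u i) / w by rewrite /y; field; rewrite gt_eqF.
exists ((D', @grid_channel R V n M y) :: l); split=> /=.
- by rewrite sl.
- split=> //; split.
  + exact: ltW.
  + by move=> v z; exact: grid_channel_ge0.
  + by move=> v; exact: sum_grid_channel.
  + move=> v u z vz uz.
    have -> : D' = om * (2 * w) by rewrite /w; field; rewrite gt_eqF.
    apply: d_cube => [|i]; first by rewrite mulr_ge0// ltW.
    have /ltW := grid_channel_close i vz uz.
    by rewrite yB normrM (gtr0_norm (x := w^-1)) ?invr_gt0// ler_pdivrMr.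
- move=> v u; split; [by rewrite /D'; field | | exact: gl].
  apply: (le_trans (grid_channel_affinity yM v u)).
  under eq_bigr do rewrite yB expr_div_n.
  rewrite -mulr_suml ler_pdivlMr ?exprn_gt0//.
  (* [D' = 2 * om * w] turns [49 / 32] into [49 / 8]. *)
  have -> : 49 / 32 * ((\sum_i (x v i - x u i) ^+ 2) / w ^+ 2) * D' ^+ 2 =
      49 / 8 * (om ^+ 2 * \sum_i (x v i - x u i) ^+ 2).
    by rewrite /w; field; rewrite !gt_eqF.
  by rewrite ler_pM2l ?d_euclid//; lra.
Qed.

Lemma multiscale_sampler (D eps : R) (K : nat) : 0 < D -> 0 < eps ->
  (forall v w, d v w <= D) ->
  exists X : (V -> R) -> R -> V, is_sampler X /\
  forall P Q (pi : V -> V -> R), is_prob P -> is_prob Q ->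
    (forall v w, 0 <= pi v w) ->
    (forall v, P v = \sum_w pi v w) -> (forall w, Q w = \sum_v pi v w) ->
    mean_dist d (X P) (X Q) <= (1 + eps) * \sum_v \sum_w pi v w *
      ((v != w)%:R * (2 * (D / 4 ^+ K) + 3615 / 100 * K%:R * (m * d v w))).
Proof.
move=> D0 e0 dD.
have [B xB] : exists B, forall v i, - B <= x v i <= B.
  exists (\sum_v \sum_i `|x v i|) => v i.
  rewrite -ler_norml (bigD1 v)//= (bigD1 i)//= -addrA lerDl addr_ge0//.
    exact: sumr_ge0.
  by apply: sumr_ge0 => u _; exact: sumr_ge0.
pose M := (Num.truncn (4 * B * om * 4 ^+ K / D)).+1.
have hM : 4 * B * om * 4 ^+ K / D <= M%:R by apply/ltW/truncnS_gt.
have [l [sl cl gl]] := multiscale_channels D0 xB hM.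
have z0 : grid n M := [ffun=> ord0].
have [X [sX hX]] := tree_sampler_exists v0 z0 d_ge0 d_refl e0 cl.
exists X; split=> // P Q pi PP QP pi0 PE QE.
have := hX D P Q (ltW D0) PP.1 QP.1.
rewrite /mass PP.2 QP.2 !normalize_id// minxx mul1r => /(_ ltr01 ltr01 _).
move=> /(_ (fun v w _ _ => dD v w)) h; apply: (le_trans h).
rewrite ler_wpM2l//; first by lra.
have PE1 v : P v = \sum_w pi v w * 1 by rewrite PE; apply: eq_bigr => w _; rewrite mulr1.
have QE1 w : Q w = \sum_v pi v w * 1 by rewrite QE; apply: eq_bigr => v _; rewrite mulr1.
apply: (le_trans (tree_cost_le_point cl (ltW D0) pi0
  (fun=> ler01) (fun=> ler01) PE1 QE1)).
apply: ler_sum => v _; apply: ler_sum => w _; rewrite ler_wpM2l//.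
have [->|vw] := eqVneq v w; first by rewrite point_cost_diag mul0r.
have md : 0 < m * d v w by rewrite mulr_gt0// d_gt0.
(* [c = 9 / 5 * (m * d)] nearly minimizes [5 * c + 8 / 3 * e / c] for
   [e = 49 / 8 * (m * d) ^ 2 = 2 * (7 / 4) ^ 2 * (m * d) ^ 2]. *)
have c0 : 0 < 9 / 5 * (m * d v w) by rewrite mulr_gt0//; lra.
have e1 : 0 <= 49 / 8 * (m * d v w) ^+ 2 by rewrite mulr_ge0// sqr_ge0.
apply: (le_trans (point_cost_quarter_scales cl (gl v w) vw D0 e1 c0 ler01 ler01)).
(* At the root both weights are 1, so the potential vanishes. Each scale costs
   [2 * (9 + 245 / 27) = 976 / 27] times [m * d v w], and [976 / 27 < 36.15]. *)
rewrite subrr normr0 mulr0 add0r sl mulr1 sqrtr1 mulr1.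
set t := m * d v w in md *.
have -> : 8 / 3 * (49 / 8 * t ^+ 2) / (9 / 5 * t) = 245 / 27 * t.
  by field; rewrite gt_eqF.
have K0 : 0 <= K%:R :> R by [].
have := mulr_ge0 K0 (ltW md); set u := D / _; set k := K%:R.
have -> : 1 + 1 - 2 = 0 :> R by ring.
by rewrite mulr0 addr0 mul1r => kt; nra.
Qed.

End multiscale.

(** * Choice of the number of scales *)

Section numerics.
Context {R : realType}.

Lemma ln_ge_div (g : R) : 0 <= g -> g / (1 + g) <= ln (1 + g).
Proof.
move=> g0; have g1 : 0 < 1 + g by lra.
have i0 : 0 < (1 + g)^-1 by rewrite invr_gt0.
have := @le_ln1Dx R ((1 + g)^-1 - 1) ltac:(lra).
rewrite addrC subrK lnV ?posrE// => h.
have -> : g / (1 + g) = 1 - (1 + g)^-1 by field; rewrite gt_eqF.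
by move: h; set u := (1 + g)^-1; lra.
Qed.

(** [1.09 ^ 16 <= 4] and [ln 1.09 >= 9 / 109], where [16 * 9 / 109 > 1.32]. *)
Lemma ln4_ge : 132 / 100 <= ln (4 : R).
Proof.
have h1 : (109 / 100 : R) ^+ 16 <= 4.
  have e2 : (109 / 100 : R) ^+ 2 <= 1189 / 1000 by lra.
  have e0 : 0 <= (109 / 100 : R) ^+ 2 by rewrite exprn_ge0//; lra.
  have e4 : ((109 / 100 : R) ^+ 2) ^+ 2 <= 1414 / 1000 by nra.
  have e8 : (((109 / 100 : R) ^+ 2) ^+ 2) ^+ 2 <= 2.
    by have := sqr_ge0 ((109 / 100 : R) ^+ 2); nra.
  have e16 : ((((109 / 100 : R) ^+ 2) ^+ 2) ^+ 2) ^+ 2 <= 4.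
    by have := sqr_ge0 (((109 / 100 : R) ^+ 2) ^+ 2); nra.
  by move: e16; rewrite -!exprM.
have p0 : 0 < 109 / 100 :> R by lra.
have : ln ((109 / 100 : R) ^+ 16) <= ln 4 by rewrite ler_ln ?posrE ?exprn_gt0.
rewrite lnXn// -[ln _ *+ 16]mulr_natr; apply: le_trans.
have -> : 109 / 100 = 1 + 9 / 100 :> R by lra.
have := @ln_ge_div (9 / 100) ltac:(lra).
have -> : 9 / 100 / (1 + 9 / 100) = 9 / 109 :> R by field.
by set u := ln _; lra.
Qed.

Lemma level_choice (g : R) : 0 < g -> exists K : nat,
  1001 / 1000 * (2 * (g / 4 ^+ K) + 3615 / 100 * K%:R) < 2866 / 100 * ln (g + 1).
Proof.
move=> g0.
have l4 := ln4_ge.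
have ln_ge4 (a b : R) : 0 < a -> a <= b -> ln a <= ln b.
  by move=> a0 ab; rewrite ler_ln ?posrE// (lt_le_trans a0).
have [g16|g16] := leP g 16.
  exists 0%N; rewrite expr0 divr1 mulr0 addr0.
  (* With no scale, [2 * g] must be compared with the logarithm: [ln (g + 1) >= g / 4] up to 3, and
     [ln (g + 1) >= ln 4] from 3 to 16. *)
  have [g3|g3] := leP g 3.
    have := ln_ge_div (ltW g0); rewrite addrC => h.
    have g4 : g / 4 <= g / (g + 1) by rewrite ler_pM2l// lef_pV2 ?posrE; lra.
    lra.
  have := @ln_ge4 4 (g + 1) ltac:(lra) ltac:(lra); lra.
(* For the least such [K], the last term [2 * (g / 4 ^ K)] is at most 32, while minimality gives
   [ln (g + 1) >= K.+1 * ln 4]. *)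
have ex : exists K, g <= 4 ^+ K.+2.
  exists (Num.truncn g); apply/ltW; apply: (lt_le_trans (truncnS_gt g)).
  rewrite -natrX ler_nat; apply: (leq_trans (ltnW (ltn_expl _ (isT : (1 < 4)%N)))).
  by rewrite leq_exp2l.
case: (ex_minnP ex) => K gK minK; exists K.
case: K gK minK => [|K] gK minK; first by move: gK; rewrite expr2; lra.
have lt : 4 ^+ K.+2 < g.
  by rewrite ltNge; apply/negP => /minK; rewrite ltnn.
have p4 : 0 < 4 ^+ K.+1 :> R by rewrite exprn_gt0.
have gd : g / 4 ^+ K.+1 <= 16.
  rewrite ler_pdivrMr//; apply: (le_trans gK).
  by rewrite [X in X <= _]exprS [X in _ * X <= _]exprS mulrA; lra.
have lnb : 132 / 100 * K.+2%:R <= ln (g + 1).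
  apply: (@le_trans _ _ (ln (4 ^+ K.+2))); last first.
    by apply: ln_ge4; [rewrite exprn_gt0 | apply/ltW/(lt_trans lt); lra].
  by rewrite lnXn// -[ln _ *+ _]mulr_natr; apply: ler_wpM2r.
have K0 : 0 <= K%:R :> R by [].
move: lnb; rewrite -[K.+2%:R]natr1 -[K.+1%:R]natr1; lra.
Qed.

End numerics.

(** * Comparison of the l_p norm with the sup and Euclidean norms *)

Section lp_bounds.
Context {R : realType} {n : nat}.
Implicit Types (h : 'rV[R]_n) (p : \bar R).

Lemma lp_norm_ge0 p h : 0 <= lp_norm p h.
Proof.
case: p => [r||] /=; first exact: powR_ge0.
  by elim/big_ind : _ => // x y x0 y0; rewrite le_max x0.
by elim/big_ind : _ => // x y x0 y0; rewrite le_max x0.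
Qed.

Lemma bigmax_abs_ge h i : `|h 0 i| <= \big[Num.max/0]_(i < n) `|h 0 i|.
Proof. by rewrite (bigD1 i)//= le_max lexx. Qed.

Lemma lp_pow_sum r h : 1 <= r ->
  lp_norm r%:E h `^ r = \sum_(i < n) `|h 0 i| `^ r.
Proof.
move=> r1 /=; rewrite -powRrM mulVf; last by rewrite gt_eqF//; lra.
by rewrite powRr1// sumr_ge0// => i _; exact: powR_ge0.
Qed.

Lemma abs_le_lp_norm p h i : (1 <= p)%E -> `|h 0 i| <= lp_norm p h.
Proof.
case: p => [r||]//; last by move=> _; exact: bigmax_abs_ge.
rewrite lee_fin => r1; have r0 : 0 < r by lra.
rewrite leNgt; apply/negP => lt.
have := gt0_ltr_powR r0 _ _ lt; rewrite !nnegrE lp_norm_ge0 normr_ge0 => /(_ isT isT).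
rewrite lp_pow_sum// (bigD1 i)//= ltNge lerDl sumr_ge0// => j _; exact: powR_ge0.
Qed.

Lemma lp_norm0 p : (1 <= p)%E -> lp_norm p (0 : 'rV[R]_n) = 0.
Proof.
case: p => [r||]//= => [|_].
  rewrite lee_fin => r1; rewrite big1 => [|i _]; last first.
    by rewrite mxE normr0 powR0//; lra.
  by rewrite powR0// invr_eq0; lra.
by elim/big_ind : _ => [//|x y -> ->|i _]; rewrite ?maxxx// mxE normr0.
Qed.

Lemma lp_norm_gt0 p h : (1 <= p)%E -> h != 0 -> 0 < lp_norm p h.
Proof.
move=> p1 h0; have [i hi] : exists i, h 0 i != 0.
  apply/existsP; apply: contraNT h0; rewrite negb_exists => /forallP hi.
  by apply/eqP/rowP => i; rewrite mxE; apply/eqP; have := hi i; rewrite negbK.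
by apply: lt_le_trans (abs_le_lp_norm h i p1); rewrite normr_gt0.
Qed.

Lemma lp_norm_cube p h t : (1 <= p)%E -> 0 <= t -> (forall i, `|h 0 i| <= t) ->
  lp_norm p h <= n%:R `^ einvr p * t.
Proof.
case: p => [r||]// => [|_] + ht; last first.
  move=> t0; rewrite /= powRr0 mul1r.
  by elim/big_ind : _ => // x y xt yt; rewrite ge_max xt.
rewrite lee_fin /= => r1 t0; have r0 : 0 < r by lra.
have -> : n%:R `^ r^-1 * t = (n%:R * t `^ r) `^ r^-1.
  by rewrite powRM ?powR_ge0// -powRrM divff ?gt_eqF// powRr1.
apply: ge0_ler_powR; rewrite ?nnegrE ?invr_ge0 ?(ltW r0)//.
- by apply: sumr_ge0 => i _; exact: powR_ge0.
- by rewrite mulr_ge0// powR_ge0.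
rewrite mulr_natl -[X in _ *+ X]card_ord -sumr_const; apply: ler_sum => i _.
by apply: ge0_ler_powR; rewrite ?nnegrE ?(ltW r0).
Qed.

(** A concave power lies below its tangent at 1. This is Young's inequality for [y ^ th] and 1 with
    exponents [1 / th] and [1 / (1 - th)]. *)
Lemma powR_le_tangent (y th : R) : 0 <= y -> 0 < th <= 1 -> y `^ th <= th * y + (1 - th).
Proof.
move=> y0 /andP[th0]; rewrite le_eqVlt => /predU1P[->|th1].
  by rewrite powRr1// mul1r subrr addr0.
have := @conjugate_powR R (y `^ th) 1 th^-1 (1 - th)^-1 (powR_ge0 _ _) ler01.
rewrite !invr_gt0 subr_gt0 !invrK => /(_ th0 th1).
by rewrite powR1 -powRrM divff ?gt_eqF// powRr1// mulr1 mul1r mulrC => -> //; lra.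
Qed.

(** In [a ^ 2 = a ^ r * a ^ (2 - r)] with [a] a coordinate, the second factor is at most that of the
    norm. *)
Lemma sum_sq_le_lp_norm r h : 1 <= r -> r <= 2 ->
  \sum_i h 0 i ^+ 2 <= lp_norm r%:E h ^+ 2.
Proof.
move=> r1 r2.
have r1E : (1 <= r%:E :> \bar R)%E by rewrite lee_fin.
set N := lp_norm r%:E h; have N0 : 0 <= N by exact: lp_norm_ge0.
have split2 (a : R) : 0 <= a -> a ^+ 2 = a `^ r * a `^ (2 - r).
  have rE : r + (2 - r) = 2 by ring.
  by move=> a0; rewrite -powRD rE ?powR_mulrn// pnatr_eq0.
rewrite (split2 N)// lp_pow_sum// mulr_suml; apply: ler_sum => i _.
rewrite -(real_normK (num_real (h 0 i))) split2// ler_wpM2l ?powR_ge0//.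
by apply: ge0_ler_powR; rewrite ?nnegrE ?subr_ge0// abs_le_lp_norm.
Qed.

(** Power means: the numbers [y i] have mean 1, so by the tangent bound their powers [2 / r] have
    mean at most 1. *)
Lemma sum_sq_le_lp_norm_card r h : 2 <= r ->
  n%:R `^ (2 / r) * \sum_i h 0 i ^+ 2 <= n%:R * lp_norm r%:E h ^+ 2.
Proof.
move=> r2; have r1 : 1 <= r by lra.
have r0 : 0 < r by lra.
have r1E : (1 <= r%:E :> \bar R)%E by rewrite lee_fin.
set N := lp_norm r%:E h; have N0 : 0 <= N by exact: lp_norm_ge0.
have [NE|Nn0] := eqVneq N 0.
  rewrite big1 ?mulr0 ?mulr_ge0 ?sqr_ge0// => i _.
  by have := abs_le_lp_norm h i r1E; rewrite -/N NE normr_le0 => /eqP ->; rewrite expr0n.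
have Np : 0 < N by rewrite lt_neqAle eq_sym Nn0.
have NrE := lp_pow_sum h r1; rewrite -/N in NrE; clearbody N.
have Nr0 : 0 < N `^ r by exact: powR_gt0.
pose y i := n%:R * (`|h 0 i| `^ r / N `^ r).
have y0 i : 0 <= y i by rewrite mulr_ge0// divr_ge0 ?powR_ge0.
have th : 0 < 2 / r <= 1 by rewrite divr_gt0//= ler_pdivrMr// mul1r.
have yth i : y i `^ (2 / r) = n%:R `^ (2 / r) * (h 0 i ^+ 2 / N ^+ 2).
  rewrite /y powRM ?divr_ge0 ?powR_ge0// powRM ?invr_ge0 ?powR_ge0//.
  have e1 : r * (2 / r) = 2 by rewrite mulrCA divff ?gt_eqF// mulr1.
  rewrite -powRN -!powRrM mulNr !e1 powRN !powR_mulrn ?normr_ge0//.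
  by rewrite real_normK ?num_real.
have sumy : \sum_i y i = n%:R.
  by rewrite -mulr_sumr -mulr_suml -NrE divff ?gt_eqF// mulr1.
have : \sum_i y i `^ (2 / r) <= n%:R.
  apply: (@le_trans _ _ (\sum_i (2 / r * y i + (1 - 2 / r)))).
    by apply: ler_sum => i _; exact: powR_le_tangent.
  rewrite big_split/= -mulr_sumr sumy sumr_const card_ord.
  by rewrite -[(1 - _) *+ n]mulr_natr -mulrDl addrC subrK mul1r.
under eq_bigr do rewrite yth.
by rewrite -mulr_sumr -mulr_suml mulrA ler_pdivrMr// exprn_gt0.
Qed.

(** For [p <= 2] the exponent satisfies [M >= 1 / p]; for larger [p], [M >= 1 / 2] gives
    [n <= n ^ (2 * M)]. *)
Lemma sum_sq_le_lp p h : (1 <= n)%N -> (1 <= p)%E ->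
  (n%:R `^ einvr p) ^+ 2 * \sum_i h 0 i ^+ 2 <=
  (n%:R `^ Num.max (einvr p) (1 - einvr p) * lp_norm p h) ^+ 2.
Proof.
move=> n1 p1; have n1R : 1 <= n%:R :> R by rewrite ler1n.
have sq (t : R) : (n%:R `^ t) ^+ 2 = n%:R `^ (t * 2).
  by rewrite -powR_mulrn ?powR_ge0// -powRrM.
rewrite exprMn !sq; set M := Num.max _ _.
have M2 : n%:R <= n%:R `^ (M * 2) :> R.
  rewrite -{1}[n%:R]powRr1//; apply: ler_powR => //.
  have : einvr p <= M by rewrite le_max lexx.
  have : 1 - einvr p <= M by rewrite le_max lexx orbT.
  lra.
have M1 : n%:R `^ (einvr p * 2) <= n%:R `^ (M * 2).
  by apply: ler_powR => //; rewrite ler_pM2r// le_max lexx.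
case: p p1 @M M1 M2 => [r||]//; last first.
  move=> _ M _ M2; rewrite mul0r powRr0 mul1r.
  apply: (@le_trans _ _ (n%:R * lp_norm +oo%E h ^+ 2)); last first.
    by rewrite ler_wpM2r// sqr_ge0.
  rewrite mulr_natl -[X in _ *+ X]card_ord -sumr_const; apply: ler_sum => i _.
  rewrite -(real_normK (num_real (h 0 i))) lerXn2r ?nnegrE ?lp_norm_ge0//.
  exact: bigmax_abs_ge.
rewrite lee_fin => r1 M M1 M2.
have [r2|/ltW r2] := leP r 2.
  apply: ler_pM; rewrite ?powR_ge0 ?sumr_ge0//; last exact: sum_sq_le_lp_norm.
  by move=> i _; rewrite sqr_ge0.
rewrite /= [r^-1 * 2]mulrC; apply: (le_trans (sum_sq_le_lp_norm_card h r2)).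
by rewrite ler_wpM2r// sqr_ge0.
Qed.

End lp_bounds.

(** * Finite subsets of l_p *)

Section finite_lp_space.
Context {R : realType} {n : nat}.
Variables (X : {fset 'rV[R]_n}) (p : \bar R) (q : R).
Hypotheses (hn : (1 <= n)%N) (hX : (2 <= #|` X|)%N) (hp : (1 <= p)%E) (hq : 1 <= q).

Definition lp_dist (v w : X) : R := lp_norm p (val v - val w).

Lemma lp_dist_refl v : lp_dist v v = 0.
Proof. by rewrite /lp_dist subrr lp_norm0. Qed.

Lemma lp_dist_ge0 v w : 0 <= lp_dist v w.
Proof. exact: lp_norm_ge0. Qed.

Lemma lp_dist_gt0 v w : v != w -> 0 < lp_dist v w.
Proof.
by move=> vw; apply: lp_norm_gt0 => //; rewrite subr_eq0 (inj_eq val_inj).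
Qed.

Lemma two_points : exists v w : X, v != w.
Proof.
have : (1 < #|{: X}|)%N by rewrite -cardfE.
by move=> /card_gt1P[v [w [_ _ vw]]]; exists v, w.
Qed.

Let diam := sup [set lp_norm p (x - y) | x in [set` X] & y in [set` X]].
Let gap := inf [set r | exists x y,
  [/\ x \in X, y \in X, x != y & r = lp_norm p (x - y)]].

Lemma lp_dist_le_diam v w : lp_dist v w <= diam.
Proof.
apply: ub_le_sup; last by exists (val v); [exact: valP | exists (val w); [exact: valP|]].
exists (\sum_v \sum_w lp_dist v w) => _ [x xX [y yX <-]].
pose v' : X := [` xX]%fset; pose w' : X := [` yX]%fset.
rewrite (bigD1 v')//= (bigD1 w')//= -addrA lerDl addr_ge0//.
  by apply: sumr_ge0 => *; exact: lp_dist_ge0.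
by apply: sumr_ge0 => *; apply: sumr_ge0 => *; exact: lp_dist_ge0.
Qed.

(** The inverse of the sum of all inverse distances works; on the diagonal [0^-1 = 0] adds
    nothing. *)
Let below_dist : exists2 b, 0 < b & forall v w, v != w -> b <= lp_dist v w.
Proof.
have [v0 [w0 vw0]] := two_points.
have inv_ge0 v w : 0 <= (lp_dist v w)^-1 by rewrite invr_ge0 lp_dist_ge0.
have inv_le v w : (lp_dist v w)^-1 <= \sum_v \sum_w (lp_dist v w)^-1.
  rewrite (bigD1 v)//= (bigD1 w)//= -addrA lerDl addr_ge0//.
    exact: sumr_ge0.
  by apply: sumr_ge0 => *; exact: sumr_ge0.
have S0 : 0 < \sum_v \sum_w (lp_dist v w)^-1.
  by apply: lt_le_trans (inv_le v0 w0); rewrite invr_gt0 lp_dist_gt0.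
exists (\sum_v \sum_w (lp_dist v w)^-1)^-1; first by rewrite invr_gt0.
by move=> v w vw; rewrite invf_ple ?posrE ?lp_dist_gt0.
Qed.

Lemma gap_gt0 : 0 < gap.
Proof.
have [b b0 hb] := below_dist; apply: (lt_le_trans b0); apply: lb_le_inf.
  have [v [w vw]] := two_points; exists (lp_dist v w), (val v), (val w).
  by split; [exact: fsvalP | exact: fsvalP | rewrite (inj_eq val_inj) |].
by move=> _ [x [y [xX yX xy ->]]]; apply: (hb [` xX]%fset [` yX]%fset).
Qed.

Lemma gap_le_lp_dist v w : v != w -> gap <= lp_dist v w.
Proof.
move=> vw; apply: ge_inf.
  by exists 0 => _ [x [y [_ _ _ ->]]]; exact: lp_norm_ge0.
by exists (val v), (val w); split; [exact: fsvalP | exact: fsvalP | rewrite (inj_eq val_inj) |].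
Qed.

Let m : R := n%:R `^ Num.max (einvr p) (1 - einvr p).
Let gamma : R := lp_aspect_ratio p X.

Lemma finite_lp_sampler : exists S : (X -> R) -> R -> X, is_sampler S /\
  exists rho : R, [/\ 1 <= rho,
    rho < (2866%:R / 100%:R) * m * gamma `^ (q - 1) * ln (gamma / m + 1) &
    forall P Q (pi : X -> X -> R), is_prob P -> is_prob Q ->
    (forall v w, 0 <= pi v w) ->
    (forall v, P v = \sum_w pi v w) -> (forall w, Q w = \sum_v pi v w) ->
    \sum_v \sum_w joint (S P) (S Q) v w * lp_dist v w `^ q <=
    rho * \sum_v \sum_w pi v w * lp_dist v w `^ q].
Proof.
have e0 : 0 < 1 / 1000 :> R by lra.
have slack (a b c : R) : a <= b ->
    (1 + 1 / 1000) * (1%:R * (2 * a + c)) <= 1001 / 1000 * (2 * b + c) by lra.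
have [v0 [w0 vw0]] := two_points.
have gap0 := gap_gt0.
have gap_diam : gap <= diam := le_trans (gap_le_lp_dist vw0) (lp_dist_le_diam v0 w0).
have diam0 : 0 < diam := lt_le_trans gap0 gap_diam.
have gammaE : gamma = diam / gap by [].
have gamma1 : 1 <= gamma by rewrite gammaE ler_pdivlMr// mul1r.
have gamma0 : 0 < gamma by rewrite (lt_le_trans ltr01).
have nR : 1 <= n%:R :> R by rewrite ler1n.
have n0 : 0 < n%:R :> R by rewrite (lt_le_trans ltr01).
have m1 : 1 <= m.
  rewrite -(powRr0 n%:R); apply: ler_powR => //.
  have : einvr p <= Num.max (einvr p) (1 - einvr p) by rewrite le_max lexx.
  have : 1 - einvr p <= Num.max (einvr p) (1 - einvr p) by rewrite le_max lexx orbT.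
  lra.
have m0 : 0 < m by rewrite (lt_le_trans ltr01).
pose g := gamma / m.
have g0 : 0 < g by rewrite divr_gt0.
(* Needed for [1 <= rho], which the definition of a coupling ratio demands. Without scales the value
   is [2.002 * gamma]. *)
have r0m (K : nat) : 1 <= 1001 / 1000 * (2 * (g / 4 ^+ K) + 3615 / 100 * K%:R) * m.
  case: K => [|k].
    have -> : 1001 / 1000 * (2 * (g / 4 ^+ 0) + 3615 / 100 * 0%:R) * m =
        2002 / 1000 * (g * m) by rewrite expr0 divr1; ring.
    by rewrite /g divfK ?gt_eqF//; lra.
  have k0 : 0 <= g / 4 ^+ k.+1 by rewrite divr_ge0 ?exprn_ge0// ltW.
  have k1 : 1 <= k.+1%:R :> R by rewrite ler1n.
  by rewrite -[leLHS]mul1r; apply: ler_pM => //; lra.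
have [K hK] := level_choice g0.
have {}r0m := r0m K.
have om0 : 0 < n%:R `^ einvr p by exact: powR_gt0.
have cube (v w : X) (t : R) : 0 <= t ->
    (forall i, `|val v 0 i - val w 0 i| <= t) -> lp_dist v w <= n%:R `^ einvr p * t.
  by move=> t0 ht; apply: lp_norm_cube => // i; rewrite !mxE.
have euclid (v w : X) : (n%:R `^ einvr p) ^+ 2 *
    \sum_i (val v 0 i - val w 0 i) ^+ 2 <= (m * lp_dist v w) ^+ 2.
  have := sum_sq_le_lp (val v - val w) hn hp.
  by under eq_bigr do rewrite !mxE.
have [S [sS hS]] := multiscale_sampler v0 lp_dist_ge0 lp_dist_refl lp_dist_gt0
  om0 m0 cube euclid K diam0 e0 lp_dist_le_diam.
exists S; split=> //.
set r0 := 1001 / 1000 * (2 * (g / 4 ^+ K) + 3615 / 100 * K%:R) in hK r0m *.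
have gq1 : 1 <= gamma `^ (q - 1).
  by rewrite -[leLHS](powRr0 gamma); apply: ler_powR => //; rewrite subr_ge0.
have gq0 : 0 < gamma `^ (q - 1) by rewrite (lt_le_trans ltr01).
exists (r0 * m * gamma `^ (q - 1)); split.
- by rewrite -[leLHS]mul1r ler_pM.
- rewrite -/g [ltRHS]mulrAC ltr_pM2r// [ltRHS]mulrAC ltr_pM2r//.
move=> P Q pi PP QP pi0 PE QE; clear hK.
(* The first factor is bounded by [diam] for the sampler and from below by [gap] for the plan; the
   loss is [gamma ^ (q - 1)]. *)
have dq v w : lp_dist v w `^ q = lp_dist v w `^ (q - 1) * lp_dist v w.
  by rewrite mulrC mulr_powRB1 ?lp_dist_ge0// (lt_le_trans ltr01).
have diamE : diam `^ (q - 1) = gamma `^ (q - 1) * gap `^ (q - 1).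
  by rewrite -powRM ?ltW// gammaE divfK// gt_eqF.
have up : \sum_v \sum_w joint (S P) (S Q) v w * lp_dist v w `^ q <=
    diam `^ (q - 1) * mean_dist lp_dist (S P) (S Q).
  rewrite /mean_dist mulr_sumr; apply: ler_sum => v _; rewrite mulr_sumr.
  apply: ler_sum => w _; rewrite dq [leRHS]mulrCA ler_wpM2l ?joint_ge0//.
  rewrite ler_wpM2r ?lp_dist_ge0//; apply: ge0_ler_powR.
  - by rewrite subr_ge0.
  - by rewrite nnegrE lp_dist_ge0.
  - by rewrite nnegrE ltW.
  - exact: lp_dist_le_diam.
apply: (le_trans up).
have := hS P Q pi PP QP pi0 PE QE => h.
apply: (@le_trans _ _ (diam `^ (q - 1) * (r0 * m * \sum_v \sum_w pi v w * lp_dist v w))).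
  rewrite ler_wpM2l ?powR_ge0//; apply: (le_trans h).
  rewrite !mulr_sumr; apply: ler_sum => v _; rewrite !mulr_sumr; apply: ler_sum => w _.
  rewrite mulrCA [leRHS]mulrCA ler_wpM2l//.
  have [->|vw] := eqVneq v w; first by rewrite mul0r mulr0 lp_dist_refl mulr0.
  have gd := gap_le_lp_dist vw.
  have dE : diam = g * m * gap by rewrite /g divfK ?gt_eqF// gammaE divfK// gt_eqF.
  (* The additive cost of the finest scale becomes proportional to the distance, as distinct points
     are at least [gap] apart. *)
  have hd : diam / 4 ^+ K <= g / 4 ^+ K * (m * lp_dist v w).
    rewrite mulrAC ler_pM2r ?invr_gt0 ?exprn_gt0// dE -mulrA ler_pM2l//.
    by rewrite ler_pM2l.
  have -> : r0 * m * lp_dist v w = 1001 / 1000 *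
     (2 * (g / 4 ^+ K * (m * lp_dist v w)) + 3615 / 100 * K%:R * (m * lp_dist v w)).
    by rewrite /r0; ring.
  exact: slack hd.
rewrite diamE.
have -> : gamma `^ (q - 1) * gap `^ (q - 1) *
    (r0 * m * (\sum_v \sum_w pi v w * lp_dist v w)) =
    r0 * m * gamma `^ (q - 1) * (gap `^ (q - 1) * \sum_v \sum_w pi v w * lp_dist v w) by ring.
rewrite ler_wpM2l//; first by rewrite mulr_ge0 ?ltW// (lt_le_trans ltr01).
rewrite mulr_sumr; apply: ler_sum => v _; rewrite mulr_sumr; apply: ler_sum => w _.
rewrite mulrCA ler_wpM2l// dq.
have [->|vw] := eqVneq v w; first by rewrite lp_dist_refl !mulr0.
rewrite ler_wpM2r ?lp_dist_ge0//; apply: ge0_ler_powR.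
- by rewrite subr_ge0.
- by rewrite nnegrE ltW.
- by rewrite nnegrE lp_dist_ge0.
- exact: gap_le_lp_dist.
Qed.

End finite_lp_space.

(** * Back to probability measures *)

Section finite_space.
Context d (T : measurableType d) (R : realType) (V : finType) (pt : V -> T) (inv : T -> V).
Hypotheses (ptK : cancel pt inv) (invK : cancel inv pt).
Hypothesis measurable_pt : forall v, measurable [set pt v].

Lemma measurable_finite_space (B : set T) : measurable B.
Proof.
rewrite (_ : B = \bigcup_(v in [set v | B (pt v)]) [set pt v]).
  by apply: fin_bigcup_measurable => //; exact: finite_finset.
apply/seteqP; split => [t Bt|t [v /= Bv ->]//].
by exists (inv t); rewrite /= invK.
Qed.

Lemma inv_preimage v : inv @^-1` [set v] = [set pt v].
Proof.
by apply/seteqP; split => t /=; [move=> <-; rewrite invK | move=> ->; rewrite ptK].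
Qed.

Lemma measure_finite_space (mu nu : {measure set T -> \bar R}) :
  (forall v, mu [set pt v] = nu [set pt v]) -> forall B, mu B = nu B.
Proof.
move=> munu B.
have mi v : measurable (inv @^-1` [set v]) by exact: measurable_finite_space.
have mB := measurable_finite_space B.
rewrite (measure_partition mu mi mB) (measure_partition nu mi mB).
apply: eq_bigr => v _; rewrite inv_preimage.
have [Bv|nBv] := pselect (B (pt v)).
  by rewrite setIidr// => _ ->.
suff -> : B `&` [set pt v] = set0 by rewrite !measure0.
by apply/seteqP; split => t // [Bt /= tv]; apply: nBv; rewrite -tv.
Qed.

Section expectation.
Context d' (Om : measurableType d') (mu : probability Om R).
Variables (c : T -> T -> R) (X Y : {RV mu >-> T}).
Hypothesis c_ge0 : forall s t, 0 <= c s t.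

(** For an arbitrary coupling of two laws, this is the plan [pi] of the finite problem. *)
Definition joint_law v w : R := fine (mu (X @^-1` [set pt v] `&` Y @^-1` [set pt w])).

Let mX v : measurable (X @^-1` [set pt v]).
Proof. exact: measurable_funPTI. Qed.

Let mY v : measurable (Y @^-1` [set pt v]).
Proof. exact: measurable_funPTI. Qed.

Lemma joint_lawE v w : mu (X @^-1` [set pt v] `&` Y @^-1` [set pt w]) = (joint_law v w)%:E.
Proof. by rewrite fineK// fin_num_measure//; exact: measurableI. Qed.

Lemma joint_law_ge0 v w : 0 <= joint_law v w.
Proof. by rewrite fine_ge0. Qed.

Lemma joint_law_suml v : (\sum_w joint_law v w)%:E = mu (X @^-1` [set pt v]).
Proof.
have YE w : (inv \o Y) @^-1` [set w] = Y @^-1` [set pt w].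
  by rewrite comp_preimage inv_preimage.
have mY' w : measurable ((inv \o Y) @^-1` [set w]) by rewrite YE.
rewrite (measure_partition mu mY' (mX v)) -sumEFin; apply: eq_bigr => w _.
by rewrite YE; exact/esym/joint_lawE.
Qed.

Lemma joint_law_sumr w : (\sum_v joint_law v w)%:E = mu (Y @^-1` [set pt w]).
Proof.
have XE v : (inv \o X) @^-1` [set v] = X @^-1` [set pt v].
  by rewrite comp_preimage inv_preimage.
have mX' v : measurable ((inv \o X) @^-1` [set v]) by rewrite XE.
rewrite (measure_partition mu mX' (mY w)) -sumEFin; apply: eq_bigr => v _.
by rewrite XE setIC; exact/esym/joint_lawE.
Qed.

(** The integrand is a finite sum of constants times indicators of the events of the joint law. *)
Lemma expectation_finite_space :
  'E_(mu)[fun t => c (X t) (Y t)]%E =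
  (\sum_v \sum_w joint_law v w * c (pt v) (pt w))%:E.
Proof.
pose A (k : V * V) := X @^-1` [set pt k.1] `&` Y @^-1` [set pt k.2].
have mA k : measurable (A k) by exact: measurableI.
have ck k : 0 <= c (pt k.1) (pt k.2) by [].
rewrite unlock.
transitivity (\int[mu]_t (\sum_(k : V * V) (c (pt k.1) (pt k.2) * \1_(A k) t)%:E))%E.
  apply: eq_integral => t _; rewrite (bigD1 (inv (X t), inv (Y t)))//= big1 ?adde0.
    by rewrite !invK indicE mem_set ?mulr1// /A /= !invK.
  move=> [v w] vw; rewrite indicE memNset ?mulr0//= => -[/= Xv Yw].
  by move: vw; rewrite Xv Yw !ptK eqxx.
rewrite ge0_integral_sum//.
- rewrite pair_big/= -sumEFin; apply: eq_bigr => k _.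
  rewrite (integralZl_indic measurableT (fun=> A k))//; last by move: (ck k); rewrite ltNge => ->.
  by rewrite integral_indic// setIT [X in (_ * X)%E](joint_lawE k.1 k.2) -EFinM mulrC.
- by move=> k; apply/measurable_EFinP; exact: measurable_funM.
- by move=> k t _; rewrite lee_fin mulr_ge0.
Qed.

End expectation.
End finite_space.

(** * Transfer to random variables on the standard probability space *)

Section unit_random_variable.
Context {R : realType}.
Notation TR := (measurableTypeR R).

(** [[0, 1]] and [[0, 1)] differ by a null point. *)
Lemma unit_lebesgue_pr (A : set TR) : measurable A -> unit_lebesgue A = (pr A)%:E.
Proof.
move=> mA.
have -> : unit_lebesgue A = lebesgue_measure (A `&` `[0, 1]%classic) by [].
rewrite -pr_fin//; have m1 : measurable (A `&` [set (1 : R)] : set TR).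
  by apply: measurableI => //; exact: measurable_set1.
have -> : A `&` `[0, 1]%classic = (A `&` unit_itv) `|` (A `&` [set 1]).
  rewrite -setIUr; congr (_ `&` _); apply/seteqP; split => t /=; rewrite /unit_itv/= !in_itv/=.
    move=> /andP[t0]; rewrite le_eqVlt => /orP[/eqP|] t1; [by right | by left; rewrite t0].
  by move=> [/andP[-> /ltW->]//|->]; rewrite ler01 lexx.
rewrite measureU//.
- rewrite [X in (_ + X)%E](_ : _ = 0%E) ?adde0//; apply/eqP; rewrite eq_le measure_ge0 andbT.
  rewrite -(@lebesgue_measure_set1 R 1); apply: le_measure; rewrite ?inE//.
- by apply: measurableI => //; exact: measurable_unit_itv.
- apply/seteqP; split => t //= [[_]]; rewrite /unit_itv/= in_itv/= => t1 [_ te].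
  by move: t1; rewrite te ltxx andbF.
Qed.

Lemma unit_RV_exists d (T : measurableType d) (V : finType) (pt : V -> T) (x : R -> V) :
  fib_measurable x -> exists X : unit_RV R T, forall t, X t = pt (x t).
Proof.
move=> mx.
have mf : measurable_fun [set: caratheodory_type ((wlength (idfun : R -> R))^*%mu)]
    (fun t : R => pt (x t)).
  move=> _ B mB; rewrite setTI; apply: sub_caratheodory.
  rewrite (_ : _ @^-1` _ = \bigcup_(v in [set v | B (pt v)]) x @^-1` [set v]).
    by apply: (@fin_bigcup_measurable _ TR) => [|v _]; [exact: finite_finset|exact: mx].
  by apply/seteqP; split => [t Bt|t [v /= Bv xv]]; [exists (x t) | rewrite /= xv].
pose X : {mfun caratheodory_type ((wlength (idfun : R -> R))^*%mu) >-> T} :=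
  HB.pack (fun t : R => pt (x t)) (isMeasurableFun.Build _ _ _ _ _ mf).
by exists X.
Qed.

End unit_random_variable.

Lemma closed_row_vector {R : realType} {n : nat} (x : 'rV[R]_n) : closed [set x].
Proof.
rewrite (_ : [set x] = \bigcap_(i in [set: 'I_n]) [set y : 'rV[R]_n | y 0 i = x 0 i]).
  apply: closed_bigI => i _.
  apply: (@closed_comp _ _ (fun y : 'rV[R]_n => y 0 i) [set x 0 i]).
    by move=> y _; exact: coord_continuous.
  exact: closed_eq.
apply/seteqP; split => [y -> //|y xy].
by apply/rowP => i; exact: xy.
Qed.

(** Singletons are closed in the ambient space, hence in the subspace, the inclusion being
    continuous and injective. *)
Lemma measurable_subset_space_point {R : realType} {n : nat} (A : set 'rV[R]_n)
  (A0 : A !=set0) (t : borel (subset_space A0)) : measurable [set t].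
Proof.
rewrite -[X in measurable X]setCK; apply: measurableC; apply: sub_sigma_algebra.
have -> : ~` [set t] = (set_val : subset_space A0 -> 'rV[R]_n) @^-1` (~` [set set_val t]).
  apply/seteqP; split => s /= st h; apply: st; last by rewrite h.
  exact: val_inj.
apply: open_comp; first by move=> s _; exact: initial_continuous.
by rewrite openC; exact: closed_row_vector.
Qed.

Theorem proposition8 (R : realType) (n : nat) (hn : (1 <= n)%N)
  (X : {fset 'rV[R]_n}) (hX : (2 <= #|` X|)%N)
  (p : \bar R) (hp : (1 <= p)%E) (q : R) (hq : 1 <= q) :
  let m : R := n%:R `^ Num.max (einvr p) (1 - einvr p) in
  let gamma : R := lp_aspect_ratio p X in
  (optimal_coupling_ratio
     (@lp_cost R n p q [set` X] (fset_gt1_nonempty hX))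
     (fun P : probability (borel (subset_space (fset_gt1_nonempty hX))) R => P)
   < ((2866%:R / 100%:R) * m * gamma `^ (q - 1) * ln (gamma / m + 1))%:E)%E.
Proof.
cbv zeta; set m := _ `^ Num.max _ _; set gamma := lp_aspect_ratio p X.
set c := @lp_cost _ _ _ _ _ _.
set T := borel _ in c *.
have mT (t : T) : measurable [set t] by exact: measurable_subset_space_point.
pose pt (v : X) : T := exist _ (val v) (mem_set (fsvalP v)).
pose inv (t : T) : X := [` set_mem (svalP t)]%fset.
have ptK : cancel pt inv by move=> v; exact: val_inj.
have invK : cancel inv pt by move=> t; exact: val_inj.
have mpt v : measurable [set pt v] by exact: mT.
have cE v w : c (pt v) (pt w) = lp_dist p v w `^ q by [].
have c_ge0 s t : 0 <= c s t by exact: powR_ge0.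
have [S [sS [rho [rho1 rho_lt hS]]]] := finite_lp_sampler hn hX hp hq.
pose law (P : probability T R) (v : X) := fine (P [set pt v]).
have lawE P v : (law P v)%:E = P [set pt v] by rewrite fineK// fin_num_measure.
have law_prob P : is_prob (law P).
  split=> [v|]; first by rewrite fine_ge0.
  apply: EFin_inj; rewrite -sumEFin -(@probability_setT _ _ _ P).
  have mi v : measurable (inv @^-1` [set v]) by exact: (measurable_finite_space invK mpt).
  rewrite (measure_partition P mi measurableT); apply: eq_bigr => v _.
  by rewrite lawE setTI (inv_preimage ptK invK).
(* The sampler, read through [pt], yields one coupling of all the laws. *)
have /choice[Y hY] : forall P : probability T R, exists Y : unit_RV R T,
    forall t, Y t = pt (S (law P) t).
  by move=> P; apply: unit_RV_exists; exact: (sS _ (law_prob P)).1.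
have mS P : fib_measurable (S (law P)) := (sS _ (law_prob P)).1.
have YE P v : Y P @^-1` [set pt v] = S (law P) @^-1` [set v].
  apply/seteqP; split => t /=; rewrite hY; last by move=> ->.
  exact: (can_inj ptK).
have hlaw P : has_law (Y P) P.
  move=> B mB.
  suff key : forall v, distribution unit_lebesgue (Y P) [set pt v] = P [set pt v].
    exact: (measure_finite_space ptK invK mpt key B).
  move=> v.
  rewrite /distribution /pushforward YE -lawE -(sS _ (law_prob P)).2.
  exact: (unit_lebesgue_pr (mS P v)).
have jointE P Q v w : joint_law pt (Y P) (Y Q) v w = joint (S (law P)) (S (law Q)) v w.
  rewrite /joint_law !YE.
  exact: (congr1 fine (unit_lebesgue_pr (measurable_joint v w (mS P) (mS Q)))).
have meanE (X1 Y1 : unit_RV R T) : mean_cost c X1 Y1 =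
    (\sum_v \sum_w joint_law pt X1 Y1 v w * lp_dist p v w `^ q)%:E.
  exact: (expectation_finite_space ptK invK mpt).
apply: (@le_lt_trans _ _ rho%:E); last by rewrite lte_fin.
apply: (@le_trans _ _ (coupling_ratio c (fun P : probability T R => P) Y)).
  by apply: ereal_inf_lbound; exists Y => // P; exact: hlaw.
apply: ereal_inf_lbound; exists rho => //; split=> // P Q.
have rho0 : 0 < rho by rewrite (lt_le_trans ltr01).
(* It suffices to compare with each competing pair [X1], [Y1], whose joint law is the plan fed to
   [hS]. *)
rewrite -lee_pdivrMl//; apply/ereal_infP => _ [X1 [Y1 [hX1 hY1 ->]]].
rewrite lee_pdivrMl// !meanE -EFinM lee_fin.
under eq_bigr do under eq_bigr do rewrite jointE.
apply: hS => //.
- by move=> v w; exact: joint_law_ge0.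
- move=> v; apply: EFin_inj; rewrite lawE (joint_law_suml ptK invK mpt).
  by rewrite -hX1.
- move=> w; apply: EFin_inj; rewrite lawE (joint_law_sumr ptK invK mpt).
  by rewrite -hY1.
Qed.
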